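(* Let $a,b\in\mathbb{C}$, $r\in\mathbb{N}$, $\mathbf{m}=(m_1,\dots,m_r)\in\mathbb{N}^r$, $m=m_1+\cdots+m_r$, $\mathbf{f}=(f_1,\dots,f_r)\in\mathbb{C}^r$. Suppose $q\in\{0,\ldots,m-1\}$, $a+m-q\notin-\mathbb{N}_0$, $a-b\notin\{q+1-m,\ldots,q\}$, and $f_j-a\notin\{m-q-m_j,m-q-m_j+1,\ldots,0\}$ for every index $1\le j\le r$ such that $m-q-m_j\le0$. Then for all $x\in\mathbb{C}\setminus[1,\infty)$ $$(1-x)^{b+q}\,{}_{r+2}F_{r+1}\left(\begin{matrix}a,b,\mathbf{f}+\mathbf{m}\\ a+m-q,\mathbf{f}\end{matrix}\,\middle|\,x\right)=\sum_{j=0}^{q}\frac{(-q)_j(a-b-q)_j}{(a+m-q)_j\,j!}\hat{Q}^0_m(-j)x^j$$ $$+x^{q+1}\frac{\hat{R}_{m-q-1}(-q-1)(b-a)_{q+1}}{(a+m-q)_{q+1}}\;{}_{m-q+1}F_{m-q}\left(\begin{matrix}1,a-b+1,\boldsymbol{\gamma}+q+2\\ a+m+1,\boldsymbol{\gamma}+q+1\end{matrix}\,\middle|\,x\right),$$ where $\boldsymbol{\gamma}=(\gamma_1,\ldots,\gamma_{m-q-1})$ are the zeros of the polynomial $\hat{R}_{m-q-1}(t)$ of degree $m-q-1$ (defined in the context), the values $\hat Q^0_m(-j)$, $0\le j\le q$, are defined in the context, and the number $\hat{R}_{m-q-1}(-q-1)$ is computed by $$\hat{R}_{m-q-1}(-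q-1)=\frac{(b)_{q+1}}{(b-a)_{q+1}}\sum_{k=0}^{q+1}\frac{(-m+k)_{q+1-k}(a)_kC_{k,r}}{(q+1-k)!}.$$
   Context: $\mathbb{N}=\{1,2,\dots\}$, $\mathbb{N}_0=\mathbb{N}\cup\{0\}$; $(z)_k=z(z+1)\cdots(z+k-1)$, $(z)_0=1$. ${}_pF_q$ is the generalized hypergeometric function $\sum_{n\ge0}\frac{(a_1)_n\cdots(a_p)_n}{(b_1)_n\cdots(b_q)_n}\frac{z^n}{n!}$, and for $p=q+1$ it is understood as its analytic continuation to $z\in\mathbb{C}\setminus[1,\infty)$; when $z$ is omitted, $z=1$. As usual, no bottom parameter is a nonpositive integer (in particular no $f_j$ is), except in terminating series, which are understood as finite sums. A vector in a parameter list stands for the list of its components: $\mathbf{f}+\mathbf{m}$ means $f_1+m_1,\dots,f_r+m_r$; $\boldsymbol{\gamma}+s$ means $\gamma_1+s,\dots,\gamma_{m-q-1}+s$ (an empty list if $m-q-1=0$). Powers of $1-x$ are principal branches. The coefficients are $C_{k,r}=\frac{(-1)^k}{k!}\,{}_{r+1}F_r\left(\begin{matrix}-k,\mathbf{f}+\mathbf{m}\\ \mathbf{f}\end{matrix}\right)=\frac{(-1)^k}{k!}\sum_{i=0}^k\frac{(-k)_i}{i!}\prod_{j=1}^r\frac{(f_j+m_j)_i}{(f_j)_i}$ for $0\le k\le m$; in particular $C_{0,r}=1$, $C_{m,r}=1/\prod_{j=1}^r(f_j)_{m_j}$. The polynomial $\hat R_{m-q-1}$ is $$\hat{R}_{m-q-1}(t)=\frac{(b)_{q+1}}{(b-a)_{q+1}}\sum_{k=0}^{q}\frac{(-m+k)_{q-k+1}(a)_{k}C_{k,r}}{(q-k+1)!}\,{}_{3}F_{2}\left(\begin{matrix}1-m+q,\,t+q+1,\,1-b-k\\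 a-b+1,\,2-k+q\end{matrix}\right)$$ $$+\sum_{k=q+1}^{m}\frac{(-1)^k(a)_{k}(b)_{k}C_{k,r}(t+q+1)_{k-q-1}}{(a-b-q)_k(k-q-1)!}\,{}_{3}F_{2}\left(\begin{matrix}-m+k,\,t+k,\,-b-q\\ a-b-q+k,\,k-q\end{matrix}\right).$$ Its zeros $\gamma_1,\dots,\gamma_{m-q-1}$ are such that $\hat R_{m-q-1}(t)=\kappa\prod_{i}(t-\gamma_i)$ with a nonzero constant $\kappa$. The values $\hat Q_m^0(-l)$ are: $\hat Q_m^0(0)=1$ and, for $l=1,\dots,q$, $$\hat{Q}_m^0(-l)=\sum_{k=0}^{l}\frac{(-1)^k(-l)_{k}(a)_k(b)_kC_{k,r}}{(-q)_k(a-b-q)_k}\,{}_{3}F_{2}\left(\begin{matrix}k-m,\,k-l,\,-b-q\\ k-q,\,a-b-q+k\end{matrix}\right),$$ where the ${}_3F_2$ is the finite sum $\sum_{i=0}^{l-k}\frac{(k-m)_i(k-l)_i(-b-q)_i}{(k-q)_i(a-b-q+k)_i\,i!}$.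
   Formalization: A bottom parameter γ_i+q+1 may equal a nonpositive integer -n only if a-b+1=-N with N≤n; termination through γ_i+q+2 is excluded, since the finite sum then gives a false identity (a=1, b=1/2, r=1, m=2, q=0, f=-7/4). *)

(* Defs.v *)
From HB Require Import structures.
From mathcomp Require Import all_boot all_order all_algebra.
From mathcomp Require Import complex.
From mathcomp Require Import all_classical all_reals all_analysis.
Set Implicit Arguments.
Unset Strict Implicit.
Unset Printing Implicit Defensive.
Import Order.TTheory GRing.Theory Num.Theory.
Import numFieldNormedType.Exports.
Local Open Scope classical_set_scope.
Local Open Scope ring_scope.
Local Open Scope complex_scope.

Definition poch (K : fieldType) (z : K) (k : nat) : K :=
  \prod_(i < k) (z + i%:R).

(* Coefficient of z^n in the hypergeometric series whose top and bottom
   parameter lists are [ups] and [lows]. *)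
Definition hyp_term (K : fieldType) (ups lows : seq K) (n : nat) : K :=
  (\prod_(u <- ups) poch u n) / ((\prod_(v <- lows) poch v n) * n`!%:R).

(* Value at 1 of a terminating hypergeometric series: a finite sum over n <= N,
   where - N is one of the top parameters. *)
Definition hyp_fin (K : fieldType) (N : nat) (ups lows : seq K) : K :=
  \sum_(n < N.+1) hyp_term ups lows n.

Definition shifted (K : fieldType) (r : nat) (f : 'I_r -> K)
    (mv : 'I_r -> nat) : seq K :=
  [seq f j + (mv j)%:R | j <- enum 'I_r].

Definition Ccoef (K : fieldType) (r : nat) (f : 'I_r -> K) (mv : 'I_r -> nat)
    (k : nat) : K :=
  (-1) ^+ k / k`!%:R
  * hyp_fin k (- k%:R :: shifted f mv) [seq f j | j <- enum 'I_r].

(* A polynomial of degree m - q - 1 in t (for generic parameters), given as a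
   function.  In the first 3F2 the terminating parameter is
   1 - m + q = - (m - q - 1), in the second one it is - m + k. *)
Definition Rhat (K : fieldType) (r : nat) (f : 'I_r -> K) (mv : 'I_r -> nat)
    (a b : K) (m q : nat) (t : K) : K :=
  poch b q.+1 / poch (b - a) q.+1
  * (\sum_(0 <= k < q.+1)
       poch (- m%:R + k%:R) (q - k + 1) * poch a k * Ccoef f mv k
       / (q - k + 1)`!%:R
       * hyp_fin (m - q - 1)
           [:: 1 - m%:R + q%:R; t + q%:R + 1; 1 - b - k%:R]
           [:: a - b + 1; 2 - k%:R + q%:R])
  + \sum_(q.+1 <= k < m.+1)
       (-1) ^+ k * poch a k * poch b k * Ccoef f mv k
       * poch (t + q%:R + 1) (k - q - 1)
       / (poch (a - b - q%:R) k * (k - q - 1)`!%:R)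
       * hyp_fin (m - k)
           [:: - m%:R + k%:R; t + k%:R; - b - q%:R]
           [:: a - b - q%:R + k%:R; k%:R - q%:R].

(* The argument l stands for the point - l, with 0 <= l <= q. *)
Definition Qhat0 (K : fieldType) (r : nat) (f : 'I_r -> K) (mv : 'I_r -> nat)
    (a b : K) (m q : nat) (l : nat) : K :=
  if l == 0%N then 1 else
  \sum_(0 <= k < l.+1)
     (-1) ^+ k * poch (- l%:R) k * poch a k * poch b k * Ccoef f mv k
     / (poch (- q%:R) k * poch (a - b - q%:R) k)
     * hyp_fin (l - k)
         [:: k%:R - m%:R; k%:R - l%:R; - b - q%:R]
         [:: k%:R - q%:R; a - b - q%:R + k%:R].

Definition cexp (R : realType) (z : R[i]) : R[i] :=
  (expR (complex.Re z) * cos (complex.Im z))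
  +i* (expR (complex.Re z) * sin (complex.Im z)).

(* Principal argument, in ]-pi, pi], of a nonzero complex number.
   [`|w|] lives in R[i], hence the real part. *)
Definition carg (R : realType) (w : R[i]) : R :=
  let t := acos (complex.Re w / complex.Re `|w|) in
  if 0 <= complex.Im w then t else - t.

Definition clog (R : realType) (w : R[i]) : R[i] :=
  ln (complex.Re `|w|) +i* carg w.

(* Principal branch of w^s *)
Definition cpow (R : realType) (w s : R[i]) : R[i] := cexp (s * clog w).

(* The power series with coefficients c centred at z0 converges at z to l. *)
Definition pseries_cvg (R : realType) (c : nat -> R[i]) (z0 z l : R[i]) :
    Prop :=
  (series (fun n => c n * (z - z0) ^+ n) : nat -> R[i]^o) @ \oo --> (l : R[i]^o).

(* F is analytic on D: near every point of D it is the sum of a power series. *)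
Definition analytic_on (R : realType) (D : set R[i]) (F : R[i] -> R[i]) :
    Prop :=
  forall z0 : R[i], D z0 -> exists c : nat -> R[i],
    \forall z \near (z0 : R[i]^o), pseries_cvg c z0 z (F z).

Definition slit_plane (R : realType) : set R[i] :=
  [set z | ~ (complex.Im z = 0 /\ 1 <= complex.Re z)].

(* F is, on the slit plane, the analytic continuation of the sum of the
   hypergeometric series with top parameters [ups] and bottom parameters
   [lows], where size ups = size lows + 1 (radius of convergence 1, or a
   terminating series).  This determines F on the slit plane.  In a series
   that terminates because of a top parameter, the terms past the end are 0
   even when a bottom Pochhammer symbol vanishes there, since x / 0 = 0. *)
Definition hyp_continuation (R : realType) (ups lows : seq R[i])
    (F : R[i] -> R[i]) : Prop :=
  analytic_on (@slit_plane R) F /\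
  forall z : R[i], `|z| < 1 -> pseries_cvg (hyp_term ups lows) 0 z (F z).

(* Main.v *)
Require Import Defs.
From HB Require Import structures.
From mathcomp Require Import all_boot all_order all_algebra.
From mathcomp Require Import complex.
From mathcomp Require Import all_classical all_reals all_analysis.
From mathcomp Require Import zify ring lra.
Import Order.TTheory GRing.Theory Num.Theory.
Import numFieldNormedType.Exports.
Set Implicit Arguments.
Unset Strict Implicit.
Unset Printing Implicit Defensive.
Local Open Scope classical_set_scope.
Local Open Scope ring_scope.
Local Open Scope complex_scope.

(* By Newton's forward difference formula,
   (f + m)_n / (f)_n = sum_k C_{k,r} n (n - 1) ... (n - k + 1).  Hence the left
   hand side is the sum over k of C_{k,r} (a)_k (b)_k / (c)_k x^k times the product
   (1 - x)^(b+q) 2F1(a + k, b + k; c + k; x), with c = a + m - q, and the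
   coefficients of each of these products are terminating 3F2 series by a
   transformation which follows from the Chu-Vandermonde and Pfaff-Saalschutz
   sums.  As b + k - (b + q) = k - q is an integer, the resulting coefficient of
   x^n is given by Qhat0(-n) if n <= q and by Rhat(-n) if n > q.  Together with
   prod_i (gamma_i + s + 1)_N / (gamma_i + s)_N = Rhat(-s-N) / Rhat(-s) this
   proves the identity on the unit disc, and it extends to the slit plane since
   both sides are analytic there and the slit plane is star-shaped about 0. *)

(** * Pochhammer symbols and terminating series *)

(** The hypergeometric identities are used with all denominators cleared, because the transformed
    3F2 has the bottom parameter k - q, a nonpositive integer when k <= q; cleared of denominators,
    a single identity serves every k and n. The exponent b + q also makes the top parameter A + B +
    D - C equal to k - m: the sum stops at m - k whatever n is, which is why the coefficients beyond
    x^q are, up to Pochhammer factors, values of one fixed polynomial. Passing to the slit plane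
    needs the principal power to be analytic there. Since principal powers are not multiplicative in
    general, the binomial series is established for (w (1 - u))^s directly, along segments that
    avoid the cut, by calculus in one real variable. *)

Section Pochhammer.
Variable K : fieldType.
Implicit Types (A B D E S z : K) (M N : nat).

Lemma poch0 z : poch z 0 = 1.
Proof. by rewrite /poch big_ord0. Qed.

Lemma pochS z k : poch z k.+1 = poch z k * (z + k%:R).
Proof. by rewrite /poch big_ord_recr. Qed.

Lemma pochSl z k : poch z k.+1 = z * poch (z + 1) k.
Proof.
rewrite /poch big_ord_recl /= addr0; congr (_ * _).
by apply: eq_bigr => i _; rewrite -addrA /bump /= natrD.
Qed.

Lemma pochD z i j : poch z (i + j) = poch z i * poch (z + i%:R) j.
Proof.
elim: j => [|j IH]; first by rewrite addn0 poch0 mulr1.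
by rewrite addnS !pochS IH natrD addrA mulrA.
Qed.

Lemma poch_eq0 z n : poch z n = 0 <-> exists2 i, (i < n)%N & z = - i%:R.
Proof.
split=> [/eqP|[i ltin ->]].
  rewrite /poch prodf_seq_eq0 => /hasP[i _ /= /eqP zi].
  by exists i => //; apply/eqP; rewrite -subr_eq0 opprK zi.
by apply/eqP; rewrite /poch prodf_seq_eq0; apply/hasP; exists (Ordinal ltin);
  rewrite ?mem_index_enum //= addNr.
Qed.

Lemma pochNn n i : poch (- n%:R : K) i = (-1) ^+ i * (n ^_ i)%:R.
Proof.
elim: i => [|i IH]; first by rewrite poch0 expr0 mul1r.
rewrite pochS IH ffactnSr exprS natrM.
have [lein|ltni] := leqP i n; first by rewrite natrB //; ring.
by rewrite ffact_small // !(mul0r, mulr0, mulr0n).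
Qed.

(** Pascal's rule in the form that drives the inductions on the length of a binomial sum. *)
Lemma sum_binS M (g : nat -> K) :
  \sum_(i < M.+2) 'C(M.+1, i)%:R * g i =
  \sum_(i < M.+1) 'C(M, i)%:R * (g i + g i.+1).
Proof.
under [RHS]eq_bigr do rewrite mulrDr.
rewrite big_split /= big_ord_recl /= bin0.
under eq_bigr => i _ do rewrite /bump /= add1n binS natrD mulrDl.
rewrite big_split /= addrA; congr (_ + _).
rewrite [RHS]big_ord_recl /= bin0; congr (_ + _).
by rewrite big_ord_recr /= bin_small // mul0r addr0.
Qed.

(** Chu-Vandermonde multiplied by (S)_M: as (S)_M = (S)_l (S + l)_{M-l}, no symbol has to be
    nonzero. *)
Lemma poch_subr_sum S E M :
  poch (S - E) M =
  \sum_(l < M.+1) 'C(M, l)%:R * ((-1) ^+ l * poch E l * poch (S + l%:R) (M - l)).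
Proof.
elim: M S => [|M IH] S.
  by rewrite big_ord_recl big_ord0 bin0 !poch0 expr0 !mulr1 addr0.
rewrite (sum_binS M (fun l => (-1) ^+ l * poch E l * poch (S + l%:R) (M.+1 - l))).
rewrite pochSl addrAC IH mulr_sumr; apply: eq_bigr => -[l /= ltl] _.
rewrite subSS subSn // pochSl pochS exprS -addrA (addrC 1) -natr1 -addrA; ring.
Qed.

(* The difference of the two sides for [M.+1] and, through
   [poch (A + D) M.+1 = (A + D) * poch (A + (D + 1)) M], those for [M] telescopes. *)
Lemma pfaff_saalschutz A B D M :
  \sum_(i < M.+1) 'C(M, i)%:R *
     (poch A i * poch B i * poch D (M - i) * poch (A + B + D + i%:R) (M - i)) =
  poch (A + D) M * poch (B + D) M.
Proof.
elim: M D => [|M IH] D.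
  by rewrite big_ord_recl big_ord0 bin0 !poch0 !mulr1 addr0.
rewrite (sum_binS M (fun i => poch A i * poch B i * poch D (M.+1 - i) *
  poch (A + B + D + i%:R) (M.+1 - i))).
rewrite !pochSl -!addrA mulrACA -IH mulr_sumr; apply/eqP.
rewrite -subr_eq0 -sumrB; apply/eqP.
(* The telescoping certificate. It vanishes at both ends: at 0 through the factor i, at M + 1
   through the binomial. *)
pose G i := - (i%:R * 'C(M, i)%:R * poch A i * poch B i
  * poch (A + B + D + i%:R) (M - i).+1 * poch (D + 1) (M - i)).
rewrite (eq_bigr (fun i : 'I_M.+1 => G i.+1 - G i)).
  by rewrite -(big_mkord xpredT (fun i => G i.+1 - G i)) telescope_sumr // /G
     bin_small // !mul0r mulr0 !mul0r !oppr0 addr0.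
move=> [i /= lti] _; rewrite /G subSS subSn //.
(* At i = M the subtraction [M - i.+1] truncates, so this index is checked apart. *)
have [ltiM|geiM] := ltnP i M; last first.
  have -> : i = M by lia.
  rewrite subnn (bin_small (ltnSn M)) binn; rewrite !pochS !poch0 -natr1; ring.
have -> : (M - i = (M - i.+1).+1)%N by lia.
have -> : i.+1%:R * 'C(M, i.+1)%:R = (M - i)%:R * 'C(M, i)%:R :> K.
  by rewrite -!natrM mul_bin_left.
set d := (M - i.+1)%N; have -> : (M - i)%:R = d%:R + 1 :> K by rewrite natr1; congr (_%:R);
  lia.
have -> : A + (B + D) = A + B + D by rewrite addrA.
have -> : A + B + (D + 1) + i%:R = A + B + D + i%:R + 1 by ring.
have -> : A + B + D + i.+1%:R = A + B + D + i%:R + 1 by rewrite -natr1; ring.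
rewrite (pochSl D) (pochSl (A + B + D + i%:R)) !(pochS _ i) (pochS (D + 1) d).
rewrite (pochSl D); ring.
Qed.

(* Equivalently, (1-x)^(-D) 2F1(A,B;C;x) has coefficients given by a terminating
   3F2 with top parameters A + B + D - C, -N, D and bottom ones A + D, B + D. *)
Lemma poch_3F2_transformation A B C D N :
  \sum_(i < N.+1) 'C(N, i)%:R *
     (poch D (N - i) * poch A i * poch B i * poch (C + i%:R) (N - i)) =
  \sum_(i < N.+1) 'C(N, i)%:R *
     ((-1) ^+ i * poch (A + B + D - C) i * poch D i
      * poch (A + D + i%:R) (N - i) * poch (B + D + i%:R) (N - i)).
Proof.
set E := A + B + D - C.
(* Expand (C + i)_{N-i} by Chu-Vandermonde, with C + i written as (A + B + D + i) - E. After the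
   exchange, the sum over i is Pfaff-Saalschutz with D + l for D. Letting l run up to N only adds
   terms with zero binomials. *)
transitivity (\sum_(0 <= i < N.+1) \sum_(0 <= l < N.+1)
  'C(N, i)%:R * 'C(N - i, l)%:R * ((-1) ^+ l * poch E l * poch D (N - i)
   * poch A i * poch B i * poch (A + B + D + i%:R + l%:R) (N - i - l))).
  rewrite big_mkord; apply: eq_bigr => -[i /= lti] _.
  have -> : C + i%:R = A + B + D + i%:R - E by rewrite /E; ring.
  rewrite poch_subr_sum (@big_cat_nat _ _ _ (N - i).+1) //=; last by lia.
  rewrite big_mkord [X in _ = _ + X]big_nat_cond [X in _ = _ + X]big1 ?addr0; last first.
    by move=> l /andP[/andP[? _] _]; rewrite (@bin_small (N - i)) ?mulr0 ?mul0r.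
  by rewrite !mulr_sumr; apply: eq_bigr => l _; ring.
rewrite exchange_big /= big_mkord; apply: eq_bigr => -[l /= ltl] _.
rewrite (@big_cat_nat _ _ _ (N - l).+1) //=; last by lia.
rewrite [X in _ + X = _]big_nat_cond [X in _ + X = _]big1 ?addr0; last first.
  move=> i /andP[/andP[? ?] _]; rewrite (@bin_small (N - i)) ?mulr0 ?mul0r //; lia.
have -> : A + D + l%:R = A + (D + l%:R) by rewrite addrA.
have -> : B + D + l%:R = B + (D + l%:R) by rewrite addrA.
rewrite -mulrA -pfaff_saalschutz mulr_sumr mulr_sumr big_mkord.
apply: eq_bigr => -[i /= lti] _.
have -> : (N - i = l + (N - l - i))%N by lia.
rewrite pochD addKn.
have -> : (N - l - i = N - i - l)%N by lia.
have -> : A + B + (D + l%:R) + i%:R = A + B + D + i%:R + l%:R by ring.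
suff -> : 'C(N, i)%:R * 'C(l + (N - i - l), l)%:R = 'C(N, l)%:R * 'C(N - l, i)%:R :> K by ring.
rewrite -!natrM; congr (_%:R).
have -> : (l + (N - i - l) = N - i)%N by lia.
have h n k : (k <= n)%N -> ('C(n, k) * (k`! * (n - k)`!) = n`!)%N by exact: bin_fact.
apply/eqP; rewrite -(eqn_pmul2r (fact_gt0 i)) -(eqn_pmul2r (fact_gt0 l)) -(eqn_pmul2r
  (fact_gt0 (N - i - l))).
have h1 := h N i; have h2 := h (N - i)%N l; have h3 := h N l; have h4 := h (N - l)%N i.
have e : (N - l - i = N - i - l)%N by lia.
rewrite e in h4.
apply/eqP; transitivity N`!.
  by rewrite -h1 ?[(N - i)`!]h2 -?h2; [ring|lia|lia].
by rewrite -h3 -?h4; [ring|lia|lia].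
Qed.
End Pochhammer.

(** * Expansion of (f + m)_n / (f)_n *)

Section ForwardDifferences.
Variable K : fieldType.
Implicit Types (g : nat -> K) (k n : nat) (s : seq K).

(** The k-th forward difference at 0. The sign exponent k + i has the parity of k - i without a
    subtraction. *)
Definition fdiff0 k g : K := \sum_(i < k.+1) 'C(k, i)%:R * ((-1) ^+ (k + i) * g i).

Lemma fdiff0S k g : fdiff0 k.+1 g = fdiff0 k (fun i => g i.+1) - fdiff0 k g.
Proof.
rewrite /fdiff0 (sum_binS k (fun i => (-1) ^+ (k.+1 + i) * g i)) -sumrB.
apply: eq_bigr => i _; rewrite addSn addnS !exprS; ring.
Qed.

Lemma newton_forward g n : g n = \sum_(k < n.+1) 'C(n, k)%:R * fdiff0 k g.
Proof.
elim: n g => [|n IH] g.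
  by rewrite /fdiff0 !big_ord_recl !big_ord0 bin0 expr0; ring.
rewrite (sum_binS n (fun k => fdiff0 k g)) (IH (fun i => g i.+1)).
by apply: eq_bigr => i _; rewrite fdiff0S; ring.
Qed.

(** A Leibniz rule, due to i C(k+1, i) = (k+1) C(k, i-1); it removes one linear factor at a time in
    [fdiff0_prod]. *)
Lemma fdiff0_linear_factor k g z :
  fdiff0 k.+1 (fun i => (i%:R + z) * g i) =
  z * fdiff0 k.+1 g + k.+1%:R * fdiff0 k (fun i => g i.+1).
Proof.
rewrite /fdiff0 big_ord_recl [X in z * X]big_ord_recl mulrDr -addrA.
congr (_ + _); first by rewrite /= bin0; ring.
rewrite !mulr_sumr -big_split; apply: eq_bigr => i _ /=.
have e : i.+1%:R * 'C(k.+1, i.+1)%:R = k.+1%:R * 'C(k, i)%:R :> K.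
  by rewrite -!natrM mul_bin_diag.
rewrite /bump /= add1n addSn addnS !exprS.
transitivity (z * ('C(k.+1, i.+1)%:R * ((-1) * (-1 * (-1) ^+ (k + i)) * g i.+1))
  + (i.+1%:R * 'C(k.+1, i.+1)%:R) * ((-1) * (-1 * (-1) ^+ (k + i)) * g i.+1)).
  by ring.
by rewrite e; ring.
Qed.

(** Differences of order k kill polynomials of degree below k. Factored form suffices here, and it
    is stable under i -> i + 1, which only shifts the list s. *)
Lemma fdiff0_prod k s : (size s < k)%N ->
  fdiff0 k (fun i => \prod_(z <- s) (i%:R + z)) = 0.
Proof.
elim: {s}(size s) {-2}s (erefl (size s)) k => [|n IH] [|z s] // sz [//|k] ltsk.
  rewrite fdiff0S; apply/eqP; rewrite subr_eq0; apply/eqP.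
  by apply: eq_bigr => i _; rewrite !big_nil.
rewrite (_ : fdiff0 _ _ =
  fdiff0 k.+1 (fun i => (i%:R + z) * \prod_(y <- s) (i%:R + y))); last first.
  by apply: eq_bigr => i _; rewrite big_cons.
case: sz => sz; rewrite fdiff0_linear_factor IH ?mulr0 ?add0r; [|by []|exact: ltnW].
rewrite (_ : fdiff0 _ _ =
  fdiff0 k (fun i => \prod_(y <- map (+%R 1) s) (i%:R + y))).
  by rewrite IH ?mulr0 ?size_map.
apply: eq_bigr => i _; rewrite big_map; congr (_ * (_ * _)).
by apply: eq_bigr => y _; rewrite -natr1 addrA.
Qed.
End ForwardDifferences.

Section Ccoef.
Variables (K : numFieldType) (r : nat) (f : 'I_r -> K) (mv : 'I_r -> nat).
Hypothesis f_bottom : forall (j : 'I_r) (n : nat), f j <> - n%:R.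

Definition shift_ratio n : K :=
  (\prod_(u <- shifted f mv) poch u n)
  / \prod_(v <- [seq f j | j <- enum 'I_r]) poch v n.

Lemma shift_ratio0 : shift_ratio 0 = 1.
Proof. by rewrite /shift_ratio !big1 ?divr1 // => *; rewrite poch0. Qed.

Lemma hyp_term_shifted ups lows n :
  hyp_term (ups ++ shifted f mv) (lows ++ [seq f j | j <- enum 'I_r]) n =
  hyp_term ups lows n * shift_ratio n.
Proof.
by rewrite /hyp_term /shift_ratio !big_cat /= !invfM; ring.
Qed.

(** Since (-k)_i / i! = (-1)^i C(k, i), the terminating series that defines C_{k,r} is an
    alternating binomial sum. *)
Lemma fact_Ccoef k : k`!%:R * Ccoef f mv k = fdiff0 k shift_ratio.
Proof.
have k0 : k`!%:R != 0 :> K by rewrite pnatr_eq0 -lt0n fact_gt0.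
rewrite /Ccoef mulrA (mulrC k`!%:R) divfK // /hyp_fin /fdiff0 mulr_sumr.
apply: eq_bigr => -[i /= lti] _.
have i0 : i`!%:R != 0 :> K by rewrite pnatr_eq0 -lt0n fact_gt0.
rewrite [hyp_term _ _ _](hyp_term_shifted [:: - k%:R] [::]).
rewrite /hyp_term big_nil big_seq1 mul1r.
rewrite pochNn -bin_ffact natrM exprD; field.
exact: i0.

Qed.

(** Splitting (f_j)_{n+m_j} in two ways gives (f_j + m_j)_n / (f_j)_n = (f_j + n)_{m_j} /
    (f_j)_{m_j}, a polynomial in n. *)
Lemma shift_ratio_prod n : shift_ratio n =
  (\prod_j poch (f j) (mv j))^-1 *
  \prod_(z <- [seq f j + i%:R | j <- enum 'I_r, i <- iota 0 (mv j)]) (n%:R + z).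
Proof.
have f0 j k : poch (f j) k != 0.
  by apply/eqP => /poch_eq0[i _ /f_bottom].
rewrite /shift_ratio /shifted 2!big_map !big_enum big_allpairs_dep big_enum /=.
rewrite -!prodfV -!big_split; apply: eq_bigr => j _ /=.
transitivity ((poch (f j) (mv j))^-1 * poch (f j + n%:R) (mv j)).
  apply: (mulfI (f0 j (mv j))); rewrite mulrA -pochD mulVKf // addnC pochD.
  by rewrite mulrAC mulfV // mul1r.
congr (_ * _); rewrite /poch -(big_mkord xpredT (fun i => f j + n%:R + i%:R)).
by rewrite /index_iota subn0; apply: eq_bigr => i _; rewrite addrAC [RHS]addrC.
Qed.

(** Newton's formula sums up to n, but a range independent of n is needed to exchange sums later.
    Cutting at m is allowed because the differences of order above m vanish, extending to m because
    n (n - 1) ... (n - k + 1) = 0 for k > n. *)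
Lemma shift_ratio_newton n :
  shift_ratio n =
  \sum_(0 <= k < (\sum_j mv j).+1) Ccoef f mv k * (n ^_ k)%:R.
Proof.
set m := (\sum_j mv j)%N.
have e k : 'C(n, k)%:R * fdiff0 k shift_ratio = Ccoef f mv k * (n ^_ k)%:R.
  by rewrite -fact_Ccoef -bin_ffact natrM; ring.
have C0 k : (m < k)%N -> Ccoef f mv k * (n ^_ k)%:R = 0.
  move=> ltmk; rewrite -e; set c := (\prod_j poch (f j) (mv j))^-1.
  set s := [seq f j + i%:R | j <- enum 'I_r, i <- iota 0 (mv j)].
  have -> : fdiff0 k shift_ratio =
      c * fdiff0 k (fun i => \prod_(z <- s) (i%:R + z)).
    rewrite /fdiff0 mulr_sumr; apply: eq_bigr => i _.
    by rewrite shift_ratio_prod -/c -/s; ring.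
  rewrite fdiff0_prod ?mulr0 // /s size_allpairs_dep.
  by rewrite sumnE big_map big_enum /= (eq_bigr mv) // => j _; rewrite size_iota.
rewrite newton_forward (eq_bigr _ (fun (k : 'I_n.+1) _ => e k)).
rewrite -(big_mkord xpredT (fun k => Ccoef f mv k * (n ^_ k)%:R)).
have z1 i j : (i <= j)%N -> (forall k, (i < k <= j)%N -> Ccoef f mv k * (n ^_ k)%:R = 0) ->
   \sum_(0 <= k < j.+1) Ccoef f mv k * (n ^_ k)%:R =
   \sum_(0 <= k < i.+1) Ccoef f mv k * (n ^_ k)%:R.
  move=> leij z; rewrite (@big_cat_nat _ _ _ i.+1) //= [X in _ + X]big_nat_cond.
  by rewrite [X in _ + X]big1 ?addr0 // => k /andP[/z].
have [lemn|ltnm] := leqP m n.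
  by apply: z1 => // k /andP[+ _]; exact: C0.
symmetry; apply: z1 => [|k /andP[ltnk _]]; first exact: ltnW.
by rewrite ffact_small ?mulr0.
Qed.
End Ccoef.

(** * Coefficients of the product *)

Section Coefficients.
Variable K : numFieldType.

Lemma fact_neq0 n : n`!%:R != 0 :> K.
Proof. by rewrite pnatr_eq0 -lt0n fact_gt0. Qed.

Lemma fact_poch (s l : nat) : s`!%:R * poch (s.+1%:R : K) l = (s + l)`!%:R.
Proof.
elim: l => [|l IH]; first by rewrite poch0 mulr1 addn0.
by rewrite pochS mulrA IH addnS factS -natrD addSn natrM mulrC.
Qed.

Lemma poch_subn_fact (n k l : nat) : (l + k <= n)%N ->
  poch (k%:R - n%:R : K) l * (n - k - l)`!%:R = (-1) ^+ l * (n - k)`!%:R.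
Proof.
move=> le; have -> : k%:R - n%:R = - (n - k)%:R :> K by rewrite natrB ?opprB //; lia.
by rewrite pochNn -mulrA -natrM ffact_fact //; lia.
Qed.

Lemma poch_subn_small (n k l : nat) : (k <= n < l + k)%N ->
  poch (k%:R - n%:R : K) l = 0.
Proof.
move=> le; have -> : k%:R - n%:R = - (n - k)%:R :> K by rewrite natrB ?opprB //; lia.
by rewrite pochNn ffact_small ?mulr0 //; lia.
Qed.

Lemma poch_reverse (z : K) n : poch (- z) n = (-1) ^+ n * poch (z - n%:R + 1) n.
Proof.
elim: n z => [|n IH] z; first by rewrite !poch0 expr0 mulr1.
rewrite pochSl exprS pochS -(natr1 n).
have -> : - z + 1 = - (z - 1) by ring.
rewrite IH; have -> : z - 1 - n%:R + 1 = z - (n%:R + 1) + 1 by ring.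
ring.
Qed.

(** The sums for a coefficient have a length depending on n, those in [Rhat] one depending on m;
    this compares them without deciding which is longer. *)
Lemma eq_sum_truncated (G1 G2 : nat -> K) N M :
  (forall i, (i <= N)%N -> (i <= M)%N -> G1 i = G2 i) ->
  (forall i, (M < i <= N)%N -> G1 i = 0) ->
  (forall i, (N < i <= M)%N -> G2 i = 0) ->
  \sum_(i < N.+1) G1 i = \sum_(i < M.+1) G2 i.
Proof.
move=> eq12 z1 z2.
have cut (G : nat -> K) L : (forall i, (minn N M < i <= L)%N -> G i = 0) -> (minn N M <=
  L)%N ->
    \sum_(i < L.+1) G i = \sum_(i < (minn N M).+1) G i.
  move=> z le; rewrite -!(big_mkord xpredT) (@big_cat_nat _ _ _ (minn N M).+1) //=.
  rewrite [X in _ + X]big_nat_cond [X in _ + X]big1 ?addr0 //.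
  by move=> i /andP[/z].
rewrite (cut G1) ?(cut G2) ?geq_minl ?geq_minr //.
- apply: eq_bigr => -[i /= lti] _; apply: eq12; lia.
- move=> i lti; apply: z2; lia.
- move=> i lti; apply: z1; lia.
Qed.

Variables (r : nat) (f : 'I_r -> K) (mv : 'I_r -> nat) (a b : K) (m q : nat).
Hypothesis f_bottom : forall (j : 'I_r) (n : nat), f j <> - n%:R.
Hypothesis m_def : m = (\sum_j mv j)%N.
Hypothesis q_lt_m : (q < m)%N.
Hypothesis c_bottom : forall n : nat, a + m%:R - q%:R <> - n%:R.
Hypothesis ab : forall i, (i <= m)%N -> poch (a - b - q%:R) i != 0.

Let c := a + m%:R - q%:R.
(** The coefficients of (1 - x)^(b+q) are (D)_n / n!. *)
Let D := - b - q%:R.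

Lemma poch_c_neq0 n : poch c n != 0.
Proof. by apply/eqP => /poch_eq0[i _ /c_bottom]. Qed.

(* coefficient of x^n in (1 - x)^(b+q) times the series of the theorem *)
Definition prod_coef n : K :=
  \sum_(j < n.+1) poch D (n - j) / (n - j)`!%:R *
    hyp_term (a :: b :: shifted f mv) (c :: [seq f j | j <- enum 'I_r]) j.

(* terms of the right hand side of [poch_3F2_transformation] for the parameters
   a + k, b + k, c + k and - b - q *)
Definition transf_term k N i : K := 'C(N, i)%:R *
  ((-1) ^+ i * poch (k%:R - m%:R) i * poch D i
   * poch (a - b - q%:R + k%:R + i%:R) (N - i) * poch (k%:R - q%:R + i%:R) (N - i)).

Definition transf_sum k N : K := \sum_(i < N.+1) transf_term k N i.

(** The factor (c)_n clears denominators, as (c)_n / (c)_j = (c + j)_{n-j}. In the part belonging to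
    k only the indices j >= k survive; shifting j by k and taking out (a)_k (b)_k leaves the left
    hand side of [poch_3F2_transformation]. *)
Lemma prod_coefE n :
  poch c n * prod_coef n =
  \sum_(0 <= k < m.+1) Ccoef f mv k *
    if (k <= n)%N then poch a k * poch b k / (n - k)`!%:R * transf_sum k (n - k) else 0.
Proof.
transitivity (\sum_(0 <= k < m.+1) \sum_(j < n.+1) Ccoef f mv k *
  (poch D (n - j) / (n - j)`!%:R * (poch a j * poch b j * poch (c + j%:R) (n - j))
    * ((j ^_ k)%:R / j`!%:R))).
  rewrite exchange_big /= mulr_sumr; apply: eq_bigr => -[j /= ltj] _.
  rewrite [hyp_term _ _ _](hyp_term_shifted f mv [:: a; b] [:: c]).
  have -> : hyp_term [:: a; b] [:: c] j = poch a j * poch b j / (poch c j * j`!%:R).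
    by rewrite /hyp_term !big_cons !big_nil !mulr1.
  rewrite shift_ratio_newton // -m_def.
  rewrite !mulr_sumr; apply: eq_bigr => k _.
  have -> : poch c n = poch c j * poch (c + j%:R) (n - j) by rewrite -pochD subnKC.
  have := poch_c_neq0 j; have := fact_neq0 j; have := fact_neq0 (n - j).
  by move=> *; field; do !(apply/andP; split).
apply: eq_bigr => k _; rewrite -mulr_sumr; congr (_ * _).
case: leqP => [lekn|ltnk]; last first.
  by rewrite big1 // => -[j /= ltj] _; rewrite ffact_small ?mul0r ?mulr0 //; lia.
set N := (n - k)%N.
have -> : transf_sum k N = \sum_(i < N.+1) 'C(N, i)%:R * (poch D (N - i) *
    poch (a + k%:R) i * poch (b + k%:R) i * poch (c + k%:R + i%:R) (N - i)).
  rewrite poch_3F2_transformation; apply: eq_bigr => i _.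
  have -> : a + k%:R + (b + k%:R) + D - (c + k%:R) = k%:R - m%:R by rewrite /D /c; ring.
  have -> : a + k%:R + D = a - b - q%:R + k%:R by rewrite /D; ring.
  by have -> : b + k%:R + D = k%:R - q%:R by rewrite /D; ring.
rewrite -(big_mkord xpredT (fun j => poch D (n - j) / (n - j)`!%:R *
  (poch a j * poch b j * poch (c + j%:R) (n - j)) * ((j ^_ k)%:R / j`!%:R))).
rewrite (@big_cat_nat _ _ _ k) //=; last by lia.
rewrite big_nat_cond big1 ?add0r; last first.
  by move=> i /andP[/andP[_ ?] _]; rewrite ffact_small ?mul0r ?mulr0.
rewrite -{1}(add0n k) big_addn subSn // -/N big_mkord mulr_sumr.
apply: eq_bigr => -[i /= lti] _.
have -> : (n - (i + k) = N - i)%N by rewrite /N; lia.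
have eN : N`!%:R = 'C(N, i)%:R * (i`!%:R * (N - i)`!%:R) :> K.
  by rewrite -!natrM bin_fact.
have eF : (i + k)`!%:R = ((i + k) ^_ k)%:R * i`!%:R :> K.
  by rewrite -natrM -{3}(addnK k i) ffact_fact // leq_addl.
have F0 : ((i + k) ^_ k)%:R != 0 :> K by rewrite pnatr_eq0 -lt0n ffact_gt0 leq_addl.
have C0 : 'C(N, i)%:R != 0 :> K by rewrite pnatr_eq0 -lt0n bin_gt0.
rewrite eN eF (addnC i k) !pochD natrD addrA.
rewrite (addnC k i); have := fact_neq0 i; have := fact_neq0 (N - i).
by move=> *; field; do !(apply/andP; split).
Qed.

Lemma hyp_term3 (u1 u2 u3 v1 v2 : K) n :
  hyp_term [:: u1; u2; u3] [:: v1; v2] n =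
  poch u1 n * poch u2 n * poch u3 n / (poch v1 n * poch v2 n * n`!%:R).
Proof. by rewrite /hyp_term !big_cons !big_nil !mulr1 !mulrA. Qed.

Lemma poch_ab_neq0 k i : (k + i <= m)%N -> poch (a - b - q%:R + k%:R) i != 0.
Proof. by move=> /ab; rewrite pochD mulf_eq0 negb_or => /andP[]. Qed.

(** For n <= q every (-q)_i with i <= n is nonzero, so the cleared sum can be divided by (-q)_n (a -
    b - q)_n, which restores an ordinary 3F2. *)
Lemma Qhat0_term n k : (k <= n)%N -> (n <= q)%N ->
  poch (- q%:R) n * poch (a - b - q%:R) n / n`!%:R *
    ((-1) ^+ k * poch (- n%:R) k * poch a k * poch b k * Ccoef f mv k
     / (poch (- q%:R) k * poch (a - b - q%:R) k)
     * hyp_fin (n - k)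
         [:: k%:R - m%:R; k%:R - n%:R; - b - q%:R]
         [:: k%:R - q%:R; a - b - q%:R + k%:R]) =
  Ccoef f mv k * (poch a k * poch b k / (n - k)`!%:R * transf_sum k (n - k)).
Proof.
move=> lekn lenq; set N := (n - k)%N.
have q0 i : (i <= q)%N -> poch (- q%:R : K) i != 0.
  by move=> le; rewrite pochNn mulf_neq0 ?signr_eq0 // pnatr_eq0 -lt0n ffact_gt0.
have q0' i : (k + i <= q)%N -> poch (k%:R - q%:R : K) i != 0.
  by rewrite addrC => /q0; rewrite pochD mulf_eq0 negb_or => /andP[].
rewrite /hyp_fin /transf_sum !mulr_sumr; apply: eq_bigr => -[i /= lti] _.
rewrite hyp_term3 /transf_term.
(* This splits the symbols of length n at k and at k + i; the other occurrences of n are folded back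
   afterwards. *)
have -> : n = (k + (i + (N - i)))%N by rewrite /N; lia.
rewrite (pochD (- q%:R)) (pochD (a - b - q%:R)) ![poch _ (i + _)]pochD.
have -> : (k + (i + (N - i)) = n)%N by rewrite /N; lia.
rewrite !(addrC (- q%:R) k%:R).
have e1 : poch (k%:R - n%:R : K) i * (N - i)`!%:R = (-1) ^+ i * N`!%:R.
  by apply: poch_subn_fact; rewrite -/N; lia.
have e2 : poch (- n%:R : K) k * N`!%:R = (-1) ^+ k * n`!%:R.
  by have := @poch_subn_fact n 0 k; rewrite sub0r subn0; apply; rewrite addn0.
have eN : 'C(N, i)%:R * (i`!%:R * (N - i)`!%:R) = N`!%:R :> K.
  by rewrite -!natrM bin_fact.
have -> : 'C(N, i)%:R = N`!%:R / (i`!%:R * (N - i)`!%:R) :> K.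
  by rewrite -eN mulfK // mulf_neq0 ?fact_neq0.
have -> : poch (k%:R - n%:R : K) i = (-1) ^+ i * N`!%:R / (N - i)`!%:R.
  by rewrite -e1 mulfK ?fact_neq0.
have -> : poch (- n%:R : K) k = (-1) ^+ k * n`!%:R / N`!%:R.
  by rewrite -e2 mulfK ?fact_neq0.
have s1 : (-1) ^+ k * (-1) ^+ k = 1 :> K by rewrite -expr2 sqrr_sign.
have h1 := @poch_ab_neq0 k i; have h2 := @ab k; have h3 := q0 k; have h4 := q0' i.
(* The squared sign is displayed because [field] treats (-1)^k as an unknown. *)
transitivity (((-1) ^+ k * (-1) ^+ k) * (Ccoef f mv k * (poch a k * poch b k / N`!%:R *
   (N`!%:R / (i`!%:R * (N - i)`!%:R) *
   ((-1) ^+ i * poch (k%:R - m%:R) i * poch D i *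
    poch (a - b - q%:R + k%:R + i%:R) (N - i) * poch (k%:R - q%:R + i%:R) (N - i)))))).
  rewrite /D; field; rewrite ?fact_neq0 ?h1 ?h2 ?h3 ?h4 //; rewrite /N in lti; lia.
by rewrite s1 mul1r.
Qed.

Lemma prod_coef_le n : (n <= q)%N ->
  poch c n * prod_coef n =
  poch (- q%:R) n * poch (a - b - q%:R) n / n`!%:R * Qhat0 f mv a b m q n.
Proof.
move=> lenq; rewrite prod_coefE.
rewrite (@big_cat_nat _ _ _ n.+1) //=; last by lia.
rewrite [X in _ + X]big_nat_cond [X in _ + X]big1 ?addr0; last first.
  by move=> k /andP[/andP[ltnk _] _]; rewrite leqNgt ltnk mulr0.
rewrite (_ : Qhat0 _ _ _ _ _ _ _ =  \sum_(0 <= k < n.+1)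
     (-1) ^+ k * poch (- n%:R) k * poch a k * poch b k * Ccoef f mv k
     / (poch (- q%:R) k * poch (a - b - q%:R) k)
     * hyp_fin (n - k)
         [:: k%:R - m%:R; k%:R - n%:R; - b - q%:R]
         [:: k%:R - q%:R; a - b - q%:R + k%:R]); last first.
  (* The separate value 1 at l = 0 agrees with the general formula, whose only term there is C_{0,r}
     = 1. *)
  rewrite /Qhat0; case: eqP => // ->; rewrite big_nat1 /hyp_fin big_ord1 hyp_term3.
  rewrite !poch0 /Ccoef /hyp_fin big_ord1 [hyp_term (- _ :: _) _ _](hyp_term_shifted f mv
    [:: _] [::]).
  by rewrite shift_ratio0 /hyp_term !big_seq1 big_nil poch0 fact0 !(mulr1, divr1, expr0).
rewrite mulr_sumr !big_nat; apply: eq_bigr => k /andP[_ ltk].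
by rewrite Qhat0_term // (ltk : (k <= n)%N).
Qed.

(** For k > q the bottom parameter k - q is positive and (k - q)_{n-k} = (n-q-1)! / (k-q-1)!; at t =
    -n the factor (t+q+1)_{k-q-1} supplies (n-q-1)! / (n-k)! up to sign. *)
Lemma Rhat_term_gt n k : (q < k)%N -> (k <= n)%N -> (k <= m)%N ->
  (-1) ^+ q.+1 * poch (a - b - q%:R) n *
    ((-1) ^+ k * poch a k * poch b k * Ccoef f mv k
       * poch (- n%:R + q%:R + 1) (k - q - 1)
       / (poch (a - b - q%:R) k * (k - q - 1)`!%:R)
       * hyp_fin (m - k)
           [:: - m%:R + k%:R; - n%:R + k%:R; - b - q%:R]
           [:: a - b - q%:R + k%:R; k%:R - q%:R]) =
  Ccoef f mv k * (poch a k * poch b k / (n - k)`!%:R * transf_sum k (n - k)).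
Proof.
move=> ltqk lekn lekm; set N := (n - k)%N.
(* Past the shorter range the longer sum vanishes, through (k - m)_i on one side and (k - n)_i on
   the other. *)
rewrite /hyp_fin /transf_sum !mulr_sumr; symmetry; apply: (@eq_sum_truncated (fun i =>
  Ccoef f mv k * (poch a k * poch b k / N`!%:R * transf_term k N i))
  (fun i => _ * (_ * hyp_term _ _ i))) => i; first 1 last.
- by move=> lti; rewrite /transf_term poch_subn_small ?(mulr0, mul0r) //; lia.
- move=> lti; rewrite hyp_term3 !(addrC (- _) k%:R) (@poch_subn_small n) ?(mulr0, mul0r) //.
  by rewrite /N in lti; lia.
move=> leiN leim; rewrite /transf_term hyp_term3.
have -> : (n = k + (i + (N - i)))%N by rewrite /N; lia.
rewrite (pochD (a - b - q%:R)) ![poch _ (i + _)]pochD.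
have -> : (k + (i + (N - i)) = n)%N by rewrite /N; lia.
rewrite !(addrC (- _) k%:R).
have e1 : poch (k%:R - n%:R : K) i * (N - i)`!%:R = (-1) ^+ i * N`!%:R.
  by apply: poch_subn_fact; rewrite -/N; lia.
have e2 : poch (- n%:R + q%:R + 1 : K) (k - q - 1) * N`!%:R =
    (-1) ^+ (k - q - 1) * (n - q.+1)`!%:R.
  have := @poch_subn_fact n q.+1 (k - q - 1).
  have -> : (n - q.+1 - (k - q - 1) = N)%N by rewrite /N; lia.
  have -> : - n%:R + q%:R + 1 = q.+1%:R - n%:R :> K by rewrite -natr1; ring.
  by apply; lia.
have eN : 'C(N, i)%:R * (i`!%:R * (N - i)`!%:R) = N`!%:R :> K.
  by rewrite -!natrM bin_fact.
have ek : k%:R - q%:R = (k - q - 1).+1%:R :> K.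
  by rewrite -natrB; [congr (_%:R); lia|exact: ltnW].
have e3 : (k - q - 1)`!%:R * (poch (k%:R - q%:R : K) i * poch (k%:R - q%:R + i%:R) (N - i))
    = (n - q.+1)`!%:R.
  by rewrite -pochD ek fact_poch; congr (_`!%:R); rewrite /N; lia.
have k0 : poch (k%:R - q%:R : K) i != 0.
  rewrite ek; have := fact_neq0 (k - q - 1 + i); rewrite -fact_poch mulf_eq0 negb_or.
  by case/andP.
have -> : 'C(N, i)%:R = N`!%:R / (i`!%:R * (N - i)`!%:R) :> K.
  by rewrite -eN mulfK // mulf_neq0 ?fact_neq0.
have -> : poch (k%:R - n%:R : K) i = (-1) ^+ i * N`!%:R / (N - i)`!%:R.
  by rewrite -e1 mulfK ?fact_neq0.
have -> : poch (- n%:R + q%:R + 1 : K) (k - q - 1) =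
   (-1) ^+ (k - q - 1) * (n - q.+1)`!%:R / N`!%:R.
  by rewrite -e2 mulfK ?fact_neq0.
rewrite -e3.
have s1 : (-1) ^+ q.+1 * (-1) ^+ k * (-1) ^+ (k - q - 1) = 1 :> K.
  have -> : (-1) ^+ k = (-1) ^+ q.+1 * (-1) ^+ (k - q - 1) :> K.
    by rewrite -exprD; congr (_ ^+ _); lia.
  by rewrite mulrA -expr2 sqrr_sign mul1r -expr2 sqrr_sign.
have h1 := @poch_ab_neq0 k i; have h2 := @ab k.
have s2 (X : K) : X = (-1) ^+ q.+1 * (-1) ^+ k * (-1) ^+ (k - q - 1) * X by rewrite s1 mul1r.
rewrite [LHS]s2 /D.
by field; rewrite ?fact_neq0 ?h1 ?h2 ?k0 //; lia.
Qed.

Lemma poch_opp_sub : poch (b - a) q.+1 = (-1) ^+ q.+1 * poch (a - b - q%:R) q.+1.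
Proof.
rewrite -opprB poch_reverse; congr (_ * poch _ _).
by rewrite -(natr1 q); ring.
Qed.

(** The factors of (k - q + i)_{n-k-i} run from k + i - q <= 0 to n - 1 - q >= 0, hence pass through
    0. *)
Lemma transf_term_small n k i : (k <= q < n)%N -> (i < q - k + 1)%N -> transf_term k (n -
  k) i = 0.
Proof.
move=> leq lti; rewrite /transf_term.
have -> : k%:R - q%:R + i%:R = (k + i)%:R - q%:R :> K by rewrite natrD; ring.
by rewrite (@poch_subn_small q (k + i)) ?mulr0 //; lia.
Qed.

(** The first p = q - k + 1 terms vanish. Reindexing by i = l + p splits each symbol: the parts of
    length p form the prefactor, the rest is a 3F2 whose bottom parameter 2 - k + q is p + 1. *)
Lemma Rhat_term_le n k : (k <= q < n)%N ->
  (-1) ^+ q.+1 * poch (a - b - q%:R) n *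
    (poch b q.+1 / poch (b - a) q.+1 *
      (poch (- m%:R + k%:R) (q - k + 1) * poch a k * Ccoef f mv k
       / (q - k + 1)`!%:R
       * hyp_fin (m - q - 1)
           [:: 1 - m%:R + q%:R; - n%:R + q%:R + 1; 1 - b - k%:R]
           [:: a - b + 1; 2 - k%:R + q%:R])) =
  Ccoef f mv k * (poch a k * poch b k / (n - k)`!%:R * transf_sum k (n - k)).
Proof.
move=> leqn; set N := (n - k)%N; set p := (q - k + 1)%N.
rewrite /hyp_fin /transf_sum -(big_mkord xpredT (transf_term k N)).
rewrite (@big_cat_nat _ _ _ p) //=; last by rewrite /p /N; lia.
rewrite [X in _ * (X + _)]big_nat_cond [X in _ * (X + _)]big1 ?add0r; last first.
  by move=> i /andP[/andP[_ ?] _]; apply: transf_term_small.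
rewrite -[X in \sum_(X <= _ < _) transf_term _ _ _](add0n p) big_addn.
have -> : (N.+1 - p = (n - q.+1).+1)%N by rewrite /p /N; lia.
rewrite big_mkord !mulr_sumr; symmetry.
apply: (@eq_sum_truncated
  (fun l => Ccoef f mv k * (poch a k * poch b k / N`!%:R * transf_term k N (l + p)))
  (fun l => _ * (_ * (_ * hyp_term _ _ l)))) => l; first 1 last.
- move=> ltl; rewrite /transf_term (@poch_subn_small m) ?(mulr0, mul0r) //.
  by rewrite /p; lia.
- move=> ltl; rewrite hyp_term3.
  have -> : - n%:R + q%:R + 1 = q.+1%:R - n%:R :> K by rewrite -natr1; ring.
  by rewrite (@poch_subn_small n) ?(mulr0, mul0r) //; lia.
move=> leln lelm; rewrite hyp_term3 /transf_term.
set M := (n - q.+1)%N.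
have -> : (N - (l + p) = M - l)%N by rewrite /N /M /p; lia.
have ep : p%:R = q%:R - k%:R + 1 :> K by rewrite /p natrD natrB //; lia.
have e1 : poch (k%:R - m%:R : K) (l + p) = poch (- m%:R + k%:R) p * poch (1 - m%:R + q%:R) l.
  by rewrite addnC pochD ep; congr (poch _ _ * poch _ _); ring.
(* Reversing (-b-q)_p produces (b+k)_p, which completes (b)_k to the (b)_{q+1} in front of
   [Rhat]. *)
have e2 : poch D (l + p) = (-1) ^+ p * poch (b + k%:R) p * poch (1 - b - k%:R) l.
  rewrite addnC pochD ep; congr (_ * poch _ _); last by rewrite /D; ring.
  rewrite /D (_ : - b - q%:R = - (b + q%:R)); last by ring.
  by rewrite poch_reverse ep; congr (_ * poch _ _); ring.
have e3 : a - b - q%:R + k%:R + (l + p)%:R = a - b + 1 + l%:R.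
  by rewrite natrD ep; ring.
have e4 : k%:R - q%:R + (l + p)%:R = l.+1%:R :> K.
  by rewrite natrD ep -natr1; ring.
have e5 : poch b q.+1 = poch b k * poch (b + k%:R) p.
  by rewrite -pochD; congr (poch _ _); rewrite /p; lia.
have e6 : poch (a - b - q%:R) n =
    poch (a - b - q%:R) q.+1 * (poch (a - b + 1) l * poch (a - b + 1 + l%:R) (M - l)).
  have -> : a - b + 1 = a - b - q%:R + q.+1%:R by rewrite -natr1; ring.
  rewrite -pochD subnKC // -pochD.
  by congr (poch _ _); rewrite /M; lia.
have e7 : poch (2 - k%:R + q%:R : K) l * p`!%:R = (p + l)`!%:R.
  by rewrite -fact_poch -(natr1 p) ep mulrC; congr (_ * poch _ _); ring.
have e8 : poch (- n%:R + q%:R + 1 : K) l * (M - l)`!%:R = (-1) ^+ l * M`!%:R.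
  have -> : - n%:R + q%:R + 1 = q.+1%:R - n%:R :> K by rewrite -natr1; ring.
  by apply: poch_subn_fact; rewrite /M in leln; lia.
have e9 : l`!%:R * poch (l.+1%:R : K) (M - l) = M`!%:R.
  by rewrite fact_poch subnKC.
have eN : 'C(N, l + p)%:R * ((p + l)`!%:R * (M - l)`!%:R) = N`!%:R :> K.
  rewrite -!natrM -(@bin_fact N (l + p)) ?(addnC p); last by rewrite /N /p; lia.
  by congr (_ * (_ * _`!))%:R; rewrite /N /M /p; lia.
have -> : 'C(N, l + p)%:R = N`!%:R / ((p + l)`!%:R * (M - l)`!%:R) :> K.
  by rewrite -eN mulfK // mulf_neq0 ?fact_neq0.
have -> : poch (2 - k%:R + q%:R : K) l = (p + l)`!%:R / p`!%:R.
  by rewrite -e7 mulfK ?fact_neq0.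
have -> : poch (- n%:R + q%:R + 1 : K) l = (-1) ^+ l * M`!%:R / (M - l)`!%:R.
  by rewrite -e8 mulfK ?fact_neq0.
rewrite e1 e2 e3 e4 e5 e6 poch_opp_sub -e9 exprD.
have h1 : poch (a - b + 1) l != 0.
  have : poch (a - b - q%:R) (q.+1 + l) != 0 by apply: ab; lia.
  rewrite pochD mulf_eq0 negb_or => /andP[_].
  by rewrite -natr1 (_ : a - b - q%:R + (q%:R + 1) = a - b + 1) //; ring.
have h2 := @ab q.+1.
have s1 : (-1) ^+ p * (-1) ^+ p = 1 :> K by rewrite -expr2 sqrr_sign.
have := fact_neq0 N; have := fact_neq0 (p + l); have := fact_neq0 (M - l).
have := fact_neq0 p; have := fact_neq0 l; have := h2 q_lt_m; move: h1 s1.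
have sq : (-1) ^+ q.+1 != 0 :> K by rewrite signr_eq0.
move: (N`!%:R) ((p + l)`!%:R) ((M - l)`!%:R) (p`!%:R) (l`!%:R) sq.
move: ((-1) ^+ q.+1) ((-1) ^+ p) ((-1) ^+ l) (poch _ q.+1) => sq sp sl g.
move: (poch (a - b + 1) l) (poch (a - b + 1 + l%:R) _) (poch l.+1%:R _) => h h' h''.
move: (poch (b + _) p) (poch (1 - b - _) l) (poch (- m%:R + _) p) => y1 y2 y3.
move: (poch (1 - m%:R + _) l) (poch a k) (poch b k) (Ccoef f mv k) => y4 y5 y6 y7.
move=> x1 x2 x3 x4 x5 sq0 h0 s1 g0 x50 x40 x30 x20 x10.
transitivity ((sp * sp) * (y7 * y5 * y6 * sl * y3 * y4 * y1 * y2 * h' * h'' / (x2 * x3))).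
  by field; rewrite x10 x20 x30.
rewrite s1 mul1r; field.
by rewrite h0 x20 x30 x40 x50 g0 sq0.
Qed.

Lemma prod_coef_gt n : (q < n)%N ->
  poch c n * prod_coef n =
  (-1) ^+ q.+1 * poch (a - b - q%:R) n * Rhat f mv a b m q (- n%:R).
Proof.
move=> ltqn; rewrite prod_coefE /Rhat mulrDr !mulr_sumr.
rewrite (@big_cat_nat _ _ _ q.+1) //=; last by lia.
congr (_ + _); rewrite !big_nat; apply: eq_bigr => k lek.
  have lekn : (k <= n)%N by lia.
  by rewrite lekn; symmetry; apply: Rhat_term_le; lia.
case: (leqP k n) => [lekn|ltnk]; first by symmetry; apply: Rhat_term_gt => //; lia.
(* For q < n < k the factor (q + 1 - n)_{k-q-1} is 0, matching the absent terms of [prod_coefE]. *)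
have -> : - n%:R + q%:R + 1 = q.+1%:R - n%:R :> K by rewrite -natr1; ring.
by rewrite (@poch_subn_small n) ?(mulr0, mul0r) //; lia.
Qed.

Lemma hyp_fin3_0 N (u1 u3 v1 v2 : K) : hyp_fin N [:: u1; 0; u3] [:: v1; v2] = 1.
Proof.
rewrite /hyp_fin big_ord_recl hyp_term3 !poch0 fact0 !(mulr1, divr1) big1 ?addr0 //.
by move=> i _; rewrite hyp_term3 (pochSl 0) !(mul0r, mulr0).
Qed.

(** At t = -q-1 the parameter t + q + 1 is 0, so the 3F2 in the first sum are 1; in the second sum
    only k = q + 1 remains, its 3F2 is also 1, and it becomes the last term. *)
Lemma Rhat_qS :
  Rhat f mv a b m q (- q%:R - 1) =
    poch b q.+1 / poch (b - a) q.+1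
    * \sum_(0 <= k < q.+2)
        poch (- m%:R + k%:R) (q + 1 - k) * poch a k * Ccoef f mv k
        / (q + 1 - k)`!%:R.
Proof.
rewrite /Rhat; have -> : - q%:R - 1 + q%:R + 1 = 0 :> K by ring.
rewrite [X in _ = _ * X]big_nat_recr //= mulrDr; congr (_ * _ + _).
  rewrite !big_nat; apply: eq_bigr => k lek.
  by rewrite hyp_fin3_0 mulr1 (_ : (q + 1 - k = q - k + 1)%N) //; lia.
rewrite big_ltn; last by lia.
rewrite big_nat_cond big1 ?addr0; last first.
  move=> k /andP[/andP[ltk _] _]; rewrite (_ : (k - q - 1 = (k - q.+2).+1)%N); last by lia.
  by rewrite pochSl !(mul0r, mulr0).
have -> : - q%:R - 1 + q.+1%:R = 0 :> K by rewrite -natr1; ring.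
rewrite hyp_fin3_0 addn1 (_ : (q.+1 - q - 1 = 0)%N); last by lia.
rewrite subnn !poch0 fact0 poch_opp_sub.
have h2 := @ab q.+1; have s1 : (-1) ^+ q.+1 * (-1) ^+ q.+1 = 1 :> K by rewrite -expr2
  sqrr_sign.
have := signr_eq0 K q.+1; move: ((-1) ^+ q.+1) s1 (poch _ q.+1) (h2 q_lt_m) => sg s1 y y0
  /negbT sg0.
have e : sg = sg^-1 by apply: (mulfI sg0); rewrite s1 mulfV.
by rewrite {1}e; field; rewrite sg0 y0.
Qed.
End Coefficients.

(** * Complex series and analytic functions *)

Notation normc := Normc.normc.

Section ComplexModulus.
Variable R : realType.
Implicit Types (z w : R[i]) (x : R).

Lemma normcE z : `|z| = (normc z)%:C. Proof. by []. Qed.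

Lemma normc_ge0 z : 0 <= normc z.
Proof. by have := normr_ge0 z; rewrite normcE lecE => /andP[]. Qed.

Lemma normcD z w : normc (z + w) <= normc z + normc w.
Proof. exact: le_normcD. Qed.

Lemma normcB z w : normc (z - w) = normc (w - z).
Proof. by rewrite -[LHS]normcN opprB. Qed.

Lemma normc_real x : normc x%:C = `|x|.
Proof. by rewrite /normc /= expr0n addr0 sqrtr_sqr. Qed.

Lemma normcX z n : normc (z ^+ n) = normc z ^+ n.
Proof.
elim: n => [|n IH]; first by rewrite !expr0 Normc.normc1.
by rewrite !exprS Normc.normcM IH.
Qed.

Lemma normc_sum (I : Type) (s : seq I) (F : I -> R[i]) :
  normc (\sum_(i <- s) F i) <= \sum_(i <- s) normc (F i).
Proof.
elim: s => [|i s IH]; first by rewrite !big_nil Normc.normc0.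
rewrite !big_cons; apply: le_trans (normcD _ _) _; exact: lerD.
Qed.

Lemma normc_gt0 z : (0 < normc z) = (z != 0).
Proof.
rewrite lt0r normc_ge0 andbT; congr (~~ _); apply/eqP/eqP => [/Normc.eq0_normc //|->].
exact: Normc.normc0.
Qed.

Lemma normc_dist z w : normc z <= normc w + normc (z - w).
Proof. by rewrite -{1}(subrKC w z); apply: normcD. Qed.

(** Radii in [R[i]^o] are complex; a positive one has imaginary part 0, so real radii suffice. *)
Lemma nearCP (z0 : R[i]) (P : R[i] -> Prop) :
  (\forall z \near (z0 : R[i]^o), P z) <->
  exists2 e : R, 0 < e & forall z, normc (z - z0) < e -> P z.
Proof.
split=> [/nbhs_normP[e /= e0 He]|[e e0 He]].
  have ee : e = (complex.Re e)%:C.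
    by case: e e0 {He} => e1 e2; rewrite ltcE /= => /andP[/eqP -> _].
  exists (complex.Re e) => [|z zz]; first by rewrite -ltcR -ee.
  by apply: He => /=; rewrite /ball_ /= distrC ee normcE ltcR.
apply/nbhs_normP; exists e%:C => /=; first by rewrite ltcR.
by move=> z; rewrite /ball_ /= distrC normcE ltcR; apply: He.
Qed.

(** Stated through moduli so that squeezing and comparison of real sequences apply. *)
Definition cvgC (u : nat -> R[i]) (l : R[i]) :=
  (fun n => normc (u n - l)) @ \oo --> (0 : R).

Lemma cvgCP (u : nat -> R[i]) (l : R[i]) :
  ((u : nat -> R[i]^o) @ \oo --> (l : R[i]^o)) <-> cvgC u l.
Proof.
split=> [/cvgrPdist_lt h|/cvgrPdist_lt h].
  apply/cvgrPdist_lt => e e0.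
  have e0' : 0 < e%:C by rewrite ltcR.
  have := h _ e0'; apply: filterS => n.
  by rewrite normcE ltcR sub0r normrN ger0_norm ?normc_ge0 // normcB.
apply/cvgrPdist_lt => e e0.
have ee : e = (complex.Re e)%:C.
  by case: e e0 => e1 e2; rewrite ltcE /= => /andP[/eqP -> _].
have e0' : 0 < complex.Re e by rewrite -ltcR -ee.
have := h _ e0'; apply: filterS => n.
by rewrite sub0r normrN ger0_norm ?normc_ge0 // normcB ee normcE ltcR.
Qed.

Lemma pseries_cvgP (c : nat -> R[i]) z0 z l :
  pseries_cvg c z0 z l <-> cvgC (fun N => \sum_(0 <= n < N) c n * (z - z0) ^+ n) l.
Proof. exact: cvgCP. Qed.

Lemma cvgC_le (u : nat -> R[i]) l (e : nat -> R) :
  (forall n, normc (u n - l) <= e n) -> e @ \oo --> (0 : R) -> cvgC u l.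
Proof.
move=> ule e0; apply: squeeze_cvgr (cvg_cst 0) e0.
by apply: nearW => n; rewrite normc_ge0 ule.
Qed.

Lemma cvgCD u v k l : cvgC u k -> cvgC v l -> cvgC (fun n => u n + v n) (k + l).
Proof.
move=> uk vl; apply: (@cvgC_le _ _ (fun n => normc (u n - k) + normc (v n - l))).
  by move=> n; apply: le_trans (normcD _ _); rewrite opprD addrACA.
by rewrite -[0 in X in _ --> X]addr0; apply: cvgD.
Qed.

Lemma cvgCM u v k l : cvgC u k -> cvgC v l -> cvgC (fun n => u n * v n) (k * l).
Proof.
move=> uk vl.
apply: (@cvgC_le _ _ (fun n => normc (u n - k) * normc (v n - l) +
  (normc k * normc (v n - l) + normc (u n - k) * normc l))).
  move=> n; rewrite -!Normc.normcM; apply: le_trans (lerD (lexx _) (normcD _ _)).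
  apply: le_trans (normcD _ _); rewrite le_eqVlt; apply/orP; left; apply/eqP.
  by congr normc; ring.
have -> : (0 : R) = 0 * 0 + (normc k * 0 + 0 * normc l) by rewrite !mulr0 mul0r !addr0.
apply: cvgD; first exact: cvgM.
by apply: cvgD; apply: cvgM => //; exact: cvg_cst.
Qed.

Lemma cvgC_cst k : cvgC (fun=> k) k.
Proof. by apply: (@cvgC_le _ _ (fun=> 0)); [move=> n; rewrite subrr Normc.normc0|exact:
  cvg_cst]. Qed.

Lemma cvgC_unique u k l : cvgC u k -> cvgC u l -> k = l.
Proof.
move=> uk ul; apply/eqP; rewrite -subr_eq0; apply/eqP/Normc.eq0_normc/eqP.
rewrite eq_le normc_ge0 andbT.
have h : (fun n => normc (u n - k) + normc (u n - l)) @ \oo --> (0 + 0 : R) by apply: cvgD.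
rewrite addr0 in h; apply: (cvgr_to_ge h); apply: nearW => n.
have -> : k - l = (u n - l) - (u n - k) by ring.
by apply: le_trans (normcD _ _) _; rewrite normcN addrC.
Qed.

Lemma cvgC_eventually u k : (\forall n \near \oo, u n = k) -> cvgC u k.
Proof.
move=> h; apply: cvg_near_cst; apply: filterS h => n ->.
by rewrite subrr Normc.normc0.
Qed.

Lemma cvgC_shift N u l : cvgC (fun n => u (n + N)%N) l <-> cvgC u l.
Proof. by rewrite /cvgC -(cvg_shiftn N (fun n => normc (u n - l))). Qed.

(** * Absolute convergence and Cauchy products *)

Definition abs_summable (u : nat -> R[i]) := cvgn (series (fun n => normc (u n))).

Lemma pseries_bounded c (h : R[i]) l :
  cvgC (fun N => \sum_(0 <= n < N) c n * h ^+ n) l ->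
  exists2 M, 0 <= M & forall n, normc (c n * h ^+ n) <= M.
Proof.
move=> hl.
have hb : bounded_fun (fun N => normc (\sum_(0 <= n < N) c n * h ^+ n - l)).
  by apply: cvg_seq_bounded; apply: cvgP hl.
have [M [_ HM0]] := hb.
have HM n : normc (\sum_(0 <= i < n) c i * h ^+ i - l) <= M + 1.
  by rewrite -[leLHS]ger0_norm ?normc_ge0 //; apply: HM0 => //; rewrite ltrDl.
exists ((M + 1) + (M + 1)) => [|n].
  by have := HM 0%N => H; have := le_trans (normc_ge0 _) H => ?; lra.
have -> : c n * h ^+ n = (\sum_(0 <= i < n.+1) c i * h ^+ i - l) -
    (\sum_(0 <= i < n) c i * h ^+ i - l) by rewrite big_nat_recr //=; ring.
by apply: le_trans (normcD _ _) _; rewrite normcN lerD.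
Qed.

(** Abel's lemma: the terms at h are bounded, so those at h' are dominated by a geometric series of
    ratio |h'| / |h|. *)
Lemma pseries_abs_summable c (h h' : R[i]) l :
  cvgC (fun N => \sum_(0 <= n < N) c n * h ^+ n) l -> normc h' < normc h ->
  abs_summable (fun n => c n * h' ^+ n).
Proof.
move=> hl lth; have [M Mp HM] := pseries_bounded hl.
have h0 : 0 < normc h by apply: le_lt_trans lth; apply: normc_ge0.
have rho : `|normc h' / normc h| < 1.
  by rewrite ger0_norm ?divr_ge0 ?normc_ge0 // ltr_pdivrMr ?mul1r.
apply: series_le_cvg (is_cvg_geometric_series (a := M) rho) => n.
- exact: normc_ge0.
- by rewrite /geometric /= mulr_ge0 // exprn_ge0 // divr_ge0 // normc_ge0.
- have e : c n * h' ^+ n = c n * h ^+ n * (h' / h) ^+ n.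
    rewrite expr_div_n; have : h ^+ n != 0 by rewrite expf_neq0 // -normc_gt0.
    by move=> ?; field.
  have er : normc (h' / h) = normc h' / normc h by rewrite Normc.normcM Normc.normcV.
  rewrite e Normc.normcM normcX er.
  by rewrite ler_wpM2r // exprn_ge0 // divr_ge0 // normc_ge0.
Qed.

Lemma series_cauchy_product (K : pzRingType) (u v : nat -> K) N :
  \sum_(0 <= n < N) \sum_(i < n.+1) u (n - i)%N * v i =
  \sum_(0 <= i < N) (\sum_(0 <= j < N - i) u j) * v i.
Proof.
elim: N => [|N IH]; first by rewrite !big_nil.
rewrite big_nat_recr //= IH [RHS]big_nat_recr //= -(big_mkord xpredT (fun i => u (N - i)%N
  * v i)).
rewrite big_nat_recr //= addrA -big_split /= subSn // subnn big_nat1.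
congr (_ + _); rewrite !big_nat; apply: eq_bigr => i /andP[_ lti].
by rewrite subSn 1?ltnW // [in RHS]big_nat_recr //= mulrDl.
Qed.

Lemma cauchy_product (u v : nat -> R[i]) k l :
  abs_summable u -> abs_summable v ->
  cvgC (fun N => \sum_(0 <= n < N) u n) k -> cvgC (fun N => \sum_(0 <= n < N) v n) l ->
  cvgC (fun N => \sum_(0 <= n < N) \sum_(i < n.+1) u (n - i)%N * v i) (k * l).
Proof.
move=> au av uk vl.
pose U N := \sum_(0 <= n < N) u n; pose V N := \sum_(0 <= n < N) v n.
pose A := series (fun n => normc (u n)); pose B := series (fun n => normc (v n)).
have nd (w : nat -> R[i]) : nondecreasing_seq (series (fun n => normc (w n))).
  by apply: nondecreasing_series => *; exact: normc_ge0.
have UA i j : (i <= j)%N -> normc (U j - U i) <= A j - A i.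
  move=> leij; rewrite /U /A /series /= (@big_cat_nat _ _ _ i _ _ _ _ (leq0n i) leij) /=.
  rewrite [X in _ <= X - _](@big_cat_nat _ _ _ i) //= addrAC subrr add0r addrAC subrr add0r.
  exact: normc_sum.
(* The triangle i + j < N contains the square of side N/2, so what it misses of the square of side N
   is at most the difference of the two squares for the moduli. *)
have key N : normc (\sum_(0 <= n < N) \sum_(i < n.+1) u (n - i)%N * v i - U N * V N)
    <= A N * B N - A N./2 * B N./2.
  rewrite series_cauchy_product /V mulr_sumr -sumrB.
  apply: le_trans (normc_sum _ _) _.
  have -> : A N * B N = \sum_(0 <= i < N) A N * normc (v i) by rewrite -mulr_sumr.
  have -> : A N./2 * B N./2 = \sum_(0 <= i < N./2) A N./2 * normc (v i) by rewrite -mulr_sumr.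
  rewrite lerBrDr.
  apply: (@le_trans _ _ (\sum_(0 <= i < N) (A N - A (N - i)%N) * normc (v i) +
     \sum_(0 <= i < N) A (N - i)%N * normc (v i))).
    apply: lerD.
      apply: ler_sum_nat => i _; rewrite -mulrBl Normc.normcM ler_wpM2r ?normc_ge0 //.
      by rewrite normcB UA // leq_subr.
    rewrite [leRHS](@big_cat_nat _ _ _ N./2) //=; last by lia.
    rewrite -[leLHS]addr0; apply: lerD.
      apply: ler_sum_nat => i lti; rewrite ler_wpM2r ?normc_ge0 //; apply: nd; lia.
    apply: sumr_ge0 => i _; rewrite mulr_ge0 ?normc_ge0 // sumr_ge0 // => j _.
    exact: normc_ge0.
  by rewrite -big_split /=; apply: ler_sum => i _; rewrite -mulrDl subrK.
apply: (@cvgC_le _ _ (fun N => (A N * B N - A N./2 * B N./2) + normc (U N * V N - k * l))).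
  by move=> N; apply: le_trans (lerD (key N) (lexx _)); apply: le_trans (normcD _ _);
     rewrite addrA subrK.
have hoo : half @ \oo --> \oo.
  move=> P [n _ nP]; exists n.*2 => // m /= lem; apply: nP => /=; lia.
have AB : (fun N => A N * B N) @ \oo --> limn A * limn B by apply: cvgM.
have AB2 : (fun N => A N./2 * B N./2) @ \oo --> limn A * limn B.
  exact: (@cvg_comp _ _ _ half (fun N => A N * B N) _ _ _ hoo AB).
rewrite -[0 in X in _ --> X](addr0) -[X in _ --> X + _](subrr (limn A * limn B)).
by apply: cvgD; [apply: cvgB|exact: cvgCM].
Qed.


(** * Closure properties of analytic functions *)

Lemma analytic_onM D F G : analytic_on D F -> analytic_on D G ->
  analytic_on D (fun z : R[i] => F z * G z).
Proof.
move=> aF aG z0 Dz0; have [c /nearCP[e1 e10 Hc]] := aF z0 Dz0.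
have [d /nearCP[e2 e20 Hd]] := aG z0 Dz0.
exists (fun n => \sum_(i < n.+1) c (n - i)%N * d i); apply/nearCP.
exists (Num.min e1 e2) => [|z]; first by rewrite lt_min e10.
set h := z - z0; move=> zlt.
(* Convergence at this larger w makes both series absolutely convergent at h. *)
have [w w1 w2] : exists2 w, normc h < normc w & normc w < Num.min e1 e2.
  exists ((normc h + Num.min e1 e2) / 2)%:C;
    rewrite normc_real ger0_norm; try (have := normc_ge0 h; lra).
have [cw dw] : normc w < e1 /\ normc w < e2 by move: w2; rewrite lt_min => /andP.
have ew : z0 + w - z0 = w by rewrite addrC addKr.
have /pseries_cvgP hcw : pseries_cvg c z0 (z0 + w) (F (z0 + w)) by apply: Hc; rewrite ew.
have /pseries_cvgP hdw : pseries_cvg d z0 (z0 + w) (G (z0 + w)) by apply: Hd; rewrite ew.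
rewrite ew in hcw hdw.
have ac := pseries_abs_summable hcw w1; have ad := pseries_abs_summable hdw w1.
have [cz dz] : normc h < e1 /\ normc h < e2 by move: zlt; rewrite lt_min => /andP.
have /pseries_cvgP hc := Hc z cz; have /pseries_cvgP hd := Hd z dz.
apply/pseries_cvgP; have := cauchy_product ac ad hc hd.
congr (cvgC _ _); apply/funext => N; apply: eq_bigr => n _; rewrite mulr_suml.
apply: eq_bigr => -[i /= lti] _; rewrite mulrACA -exprD subnK //.
Qed.

Lemma analytic_onD D F G : analytic_on D F -> analytic_on D G ->
  analytic_on D (fun z : R[i] => F z + G z).
Proof.
move=> aF aG z0 Dz0; have [c Hc] := aF z0 Dz0; have [d Hd] := aG z0 Dz0.
exists (fun n => c n + d n).
apply: filterS2 Hc Hd => z /pseries_cvgP hc /pseries_cvgP hd; apply/pseries_cvgP.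
have := cvgCD hc hd; congr (cvgC _ _); apply/funext => N; rewrite -big_split /=.
by apply: eq_bigr => n _; rewrite mulrDl.
Qed.

Lemma analytic_on_cst D k : analytic_on D (fun=> k : R[i]).
Proof.
move=> z0 _; exists (fun n => if n is 0%N then k else 0).
apply/nearCP; exists 1 => // z _; apply/pseries_cvgP/cvgC_eventually.
exists 1%N => // -[//|n] _; rewrite /= big_nat_recl // big1 ?addr0 ?expr0 ?mulr1 // => i _.
by rewrite mul0r.
Qed.

Lemma analytic_on_id D : analytic_on D (fun z : R[i] => z).
Proof.
move=> z0 _; exists (fun n => if n is n'.+1 then (if n' is 0%N then 1 else 0) else z0).
apply/nearCP; exists 1 => // z _; apply/pseries_cvgP/cvgC_eventually.
exists 2%N => // -[//|[//|n]] _; rewrite /= !big_nat_recl // big1 => [|i _].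
  by rewrite expr0 expr1; ring.
by rewrite mul0r.
Qed.

Lemma analytic_onX D n : analytic_on D (fun z : R[i] => z ^+ n).
Proof.
elim: n => [|n IH]; first exact: analytic_on_cst.
under eq_fun do rewrite exprS.
exact: (@analytic_onM D (fun z => z) (fun z => z ^+ n) (@analytic_on_id D) IH).
Qed.

Lemma analytic_on_sum D (I : Type) (s : seq I) (F : I -> R[i] -> R[i]) :
  (forall i, analytic_on D (F i)) -> analytic_on D (fun z => \sum_(i <- s) F i z).
Proof.
move=> aF; elim: s => [|i s IH].
  by under eq_fun do rewrite big_nil; apply: analytic_on_cst.
under eq_fun do rewrite big_cons.
exact: (@analytic_onD D (F i) (fun z => \sum_(j <- s) F j z) (aF i) IH).
Qed.
End ComplexModulus.

(** * Identity theorem on the slit plane *)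

Section IdentityTheorem.
Variable R : realType.
Implicit Types (z w : R[i]) (x : R).

Lemma geometric_tail (t : R) n N : 0 <= t <= 1 / 2 ->
  \sum_(n.+1 <= k < N) t ^+ k <= 2 * t ^+ n.+1.
Proof.
move=> /andP[t0 t1]; have tk k : 0 <= t ^+ k by rewrite exprn_ge0.
have [le|lt] := leqP N n.+1; first by rewrite big_geq // mulr_ge0.
suff H k : \sum_(n.+1 <= k < n.+1 + k) t ^+ k <= 2 * t ^+ n.+1 - 2 * t ^+ (n.+1 + k).
  have := H (N - n.+1)%N; rewrite subnKC 1?ltnW // => /le_trans; apply.
  by rewrite gerBl mulr_ge0.
elim: k => [|k IH]; first by rewrite addn0 big_geq // subrr.
rewrite addnS big_nat_recr ?leq_addr //= (exprS t (n.+1 + k)).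
have h := tk (n.+1 + k)%N.
have : t * t ^+ (n.+1 + k) <= 1 / 2 * t ^+ (n.+1 + k) by rewrite ler_wpM2r.
by lra.
Qed.

(** Zeros are isolated: if all earlier coefficients vanish, a zero at distance |h| forces |c n| <= C
    |h|, which is impossible for nonzero c n once h is small. *)
Lemma pseries_eq0 c z0 (H : R[i] -> R[i]) :
  (\forall z \near (z0 : R[i]^o), pseries_cvg c z0 z (H z)) ->
  (forall e : R, 0 < e -> exists z, [/\ z != z0, normc (z - z0) < e & H z = 0]) ->
  forall n, c n = 0.
Proof.
move=> /nearCP[e e0 He] Hz n.
have [r [r0 re]] : exists r : R, 0 < r /\ r < e by exists (e / 2); lra.
have nr : normc r%:C = r by rewrite normc_real ger0_norm // ltW.
have /pseries_cvgP hr : pseries_cvg c z0 (z0 + r%:C) (H (z0 + r%:C)).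
  by apply: He; rewrite addrC addKr nr.
rewrite (_ : z0 + r%:C - z0 = r%:C) in hr; last by rewrite addrC addKr.
have [M M0 HM] := pseries_bounded hr.
elim/ltn_ind: n => n IH; apply: Normc.eq0_normc; apply/eqP; rewrite eq_le normc_ge0 andbT.
(* With t = |h| / r <= 1/2 the tail past n is at most 2 M t^(n+1) = C |h|^(n+1). *)
rewrite leNgt; apply/negP => cn0; set C := 2 * M / r ^+ n.+1.
have rn0 : 0 < r ^+ n.+1 by rewrite exprn_gt0.
have C0 : 0 <= C by rewrite divr_ge0 ?mulr_ge0 // ltW.
(* The first bound gives t <= 1/2, the second C |h| < |c n|; the denominator is C + 1 because C may
   be 0. *)
have d0 : 0 < Num.min (r / 2) (normc (c n) / (C + 1)).
  by rewrite lt_min !divr_gt0 //; lra.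
have [z [zz0 + Hz0]] := Hz _ d0.
rewrite lt_min => /andP[zr zc]; set h := z - z0 in zr zc.
have h0 : 0 < normc h by rewrite normc_gt0 subr_eq0.
have /pseries_cvgP : pseries_cvg c z0 z (H z) by apply: He; rewrite -/h; lra.
rewrite Hz0 -/h => hP; set t := normc h / r.
have t0 : 0 <= t by rewrite divr_ge0 // ltW.
have t1 : t <= 1 / 2 by rewrite ler_pdivrMr //; lra.
have hk k : normc (c k * h ^+ k) <= M * t ^+ k.
  have -> : c k * h ^+ k = (c k * r%:C ^+ k) * (h / r%:C) ^+ k.
    have rC : r%:C ^+ k != 0 by rewrite expf_neq0 // -normc_gt0 nr.
    by rewrite expr_div_n; field.
  have er : normc (h / r%:C) = t by rewrite Normc.normcM Normc.normcV nr.
  by rewrite Normc.normcM normcX er ler_wpM2r ?exprn_ge0.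
have bnd : normc (c n * h ^+ n) <= 2 * M * t ^+ n.+1.
  have hl : (fun N => normc (\sum_(0 <= k < N) c k * h ^+ k - 0) + 2 * M * t ^+ n.+1)
      @ \oo --> 0 + 2 * M * t ^+ n.+1 by apply: cvgD => //; apply: cvg_cst.
  rewrite add0r in hl; apply: (cvgr_to_ge hl); exists n.+1 => // N /= ltnN.
  rewrite subr0 (@big_cat_nat _ _ _ n.+1) //= big_nat_recr //= big_nat_cond big1 ?add0r.
    set T := \sum_(n.+1 <= i < N) _.
    rewrite -[X in normc X <= _](addrK T).
    apply: le_trans (normcD _ _) _; rewrite normcN lerD2l.
    apply: le_trans (normc_sum _ _) _.
    apply: (@le_trans _ _ (\sum_(n.+1 <= i < N) M * t ^+ i)).
      by apply: ler_sum => i _; apply: hk.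
    rewrite -mulr_sumr (mulrC 2) -mulrA.
    by rewrite ler_wpM2l // geometric_tail // t0.
  by move=> k /andP[/andP[_ /IH ->] _]; rewrite mul0r.
have : normc (c n) <= C * normc h.
  rewrite -(ler_pM2r (exprn_gt0 n h0)) -normcX -Normc.normcM (le_trans bnd) //.
  rewrite normcX /C /t expr_div_n -[leRHS]mulrA -exprS.
  by rewrite le_eqVlt; apply/orP; left; apply/eqP; field; lra.
apply/negP; rewrite -ltNge.
apply: (@le_lt_trans _ _ (C * (normc (c n) / (C + 1)))).
  by rewrite ler_wpM2l // ltW.
by rewrite mulrA ltr_pdivrMr ?ltr_wpDl // mulrC ltr_pM2l //; lra.
Qed.

Lemma slit_plane_star x z : 0 <= x <= 1 -> @slit_plane R z -> @slit_plane R (x%:C * z).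
Proof.
move=> /andP[x0 x1] sz [/= im re]; apply: sz; case: z im re => u v /=.
rewrite !mul0r subr0 addr0 => im re.
have u0 : 0 < x * u by lra.
have xp : 0 < x by rewrite lt_neqAle x0 andbT; apply/eqP => x00; move: u0; rewrite -x00
  mul0r ltxx.
split; first by move/eqP: im; rewrite mulf_eq0 gt_eqF //= => /eqP.
by apply: (le_trans re); rewrite ler_piMl // -(pmulr_rge0 _ xp) ltW.
Qed.

(** Connectedness of [0, 1]: the t such that H vanishes near t x form a nonempty open subset. It is
    closed, since at a limit point zeros accumulate at t x and [pseries_eq0] annihilates the local
    expansion. *)
Lemma analytic_slit_identity (H : R[i] -> R[i]) :
  analytic_on (@slit_plane R) H -> (forall z, normc z < 1 -> H z = 0) ->
  forall z, slit_plane z -> H z = 0.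
Proof.
move=> aH H0 x sx.
pose Z t := exists2 e : R, 0 < e & forall z, normc (z - t%:C * x) < e -> H z = 0.
pose B := `[0, 1]%classic `&` [set t : R | Z t].
suff B1 : B = `[0, 1]%classic.
  have : B 1 by rewrite B1 /= in_itv /= ler01 lexx.
  by case=> _ [e e0 He]; apply: He; rewrite mul1r subrr Normc.normc0.
have dist s t : normc (s%:C * x - t%:C * x) = `|s - t| * normc x.
  by rewrite -mulrBl Normc.normcM -rmorphB normc_real.
have near_dist e : 0 < e -> exists2 d : R, 0 < d &
    forall s t : R, `|s - t| < d -> normc (s%:C * x - t%:C * x) < e.
  move=> e0; have n0 := normc_ge0 x; exists (e / (normc x + 1)).
    by rewrite divr_gt0 //; lra.
  move=> s t; rewrite dist ltr_pdivlMr; last by lra.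
  by have := normr_ge0 (s - t); rewrite mulrDr; lra.
apply: segment_connected.
- exists 0; split; first by rewrite /= in_itv /= lexx ler01.
  by exists 1 => // z; rewrite mul0r subr0; apply: H0.
- exists [set t | Z t] => //; rewrite openE => t /= [e e0 He].
  have [d d0 Hd] := near_dist (e / 2) ltac:(lra).
  apply/nbhs_ballP; exists d => // s; rewrite /ball /= => st.
  exists (e / 2) => [|z zs]; first by lra.
  apply: He; have := normcD (z - s%:C * x) (s%:C * x - t%:C * x).
  by rewrite subrKA; have := Hd s t; rewrite distrC => /(_ st); lra.
- exists (closure B); first exact: closed_closure.
  apply/seteqP; split => [t Bt|t [It cBt]]; first by split; [case: Bt|apply: subset_closure].
  split => //.
  have st : slit_plane (t%:C * x) by apply: slit_plane_star => //; move: It; rewrite /= in_itv.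
  have [c Hc] := aH _ st.
  have c0 : forall n, c n = 0.
    apply: (pseries_eq0 Hc) => e e0.
    have [d d0 Hd] := near_dist (e / 2) ltac:(lra).
    have /cBt [s [[_ [e' e'0 He']]]] : nbhs t (ball t d) by apply: nbhsx_ballx.
    rewrite /ball /= distrC => sd.
    have zero (y : R) : 0 < y -> y < e' -> y < e / 2 ->
        normc (s%:C * x + y%:C - t%:C * x) < e /\ H (s%:C * x + y%:C) = 0.
      move=> y0 y1 y2; have ny : normc y%:C = y by rewrite normc_real ger0_norm // ltW.
      split; last by apply: He'; rewrite addrC addKr ny.
      have := normcD (s%:C * x - t%:C * x) y%:C; rewrite ny addrAC.
      by have := Hd s t sd; lra.
    have [y [y0 y1 y2]] : exists y : R, [/\ 0 < y, y < e' & y < e / 2].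
      exists (Num.min e' (e / 2) / 2).
      have : 0 < Num.min e' (e / 2) by rewrite lt_min e'0; lra.
      have : Num.min e' (e / 2) <= e' by rewrite ge_min lexx.
      have : Num.min e' (e / 2) <= e / 2 by rewrite ge_min lexx orbT.
      by move=> *; split; lra.
    (* The zero must differ from t x; if the displacement y lands on it, y / 2 does not. *)
    have [z1|z1] := eqVneq (s%:C * x + y%:C) (t%:C * x).
      exists (s%:C * x + (y / 2)%:C).
      have [|||l1 l2] := zero (y / 2); [lra|lra|lra|split => //].
      rewrite -z1 (inj_eq (addrI _)) (inj_eq (@complexI _)); apply/eqP; lra.
    by exists (s%:C * x + y%:C); have [] := zero y.
  have /nearCP[e e0 He] := Hc; exists e => // z /He/pseries_cvgP hz.
  apply: cvgC_unique hz _; apply: cvgC_eventually; apply: nearW => N.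
  by rewrite big1 // => i _; rewrite c0 mul0r.
Qed.
End IdentityTheorem.

(** * Complex powers *)

Section ComplexPower.
Variable R : realType.
Implicit Types (z w s : R[i]) (x y t : R).

Definition off_cut w := ~ (complex.Im w = 0 /\ complex.Re w <= 0).

Lemma off_cutE u v : off_cut (u +i* v) ->
  0 < u ^+ 2 + v ^+ 2 /\ 0 < u + Num.sqrt (u ^+ 2 + v ^+ 2).
Proof.
rewrite /off_cut /= => Huv.
have N0 : 0 <= u ^+ 2 + v ^+ 2 by rewrite addr_ge0 ?sqr_ge0.
have [u0|u0] := ltP 0 u.
  by split; [rewrite ltr_pwDl ?exprn_gt0 ?sqr_ge0|rewrite ltr_pwDl ?sqrtr_ge0].
have v0 : v != 0 by apply/eqP => v0; apply: Huv.
have v2 : 0 < v ^+ 2 by rewrite exprn_even_gt0.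
have N1 : 0 < u ^+ 2 + v ^+ 2 by rewrite ltr_wpDl ?sqr_ge0.
split=> //; rewrite -ltrBlDl sub0r -(@ltr_pXn2r _ 2) ?nnegrE ?sqrtr_ge0 ?oppr_ge0 //.
by rewrite sqr_sqrtr // sqrrN ltrDl.
Qed.

(* By the half-angle formula this is [carg] off the cut; unlike the two branches of
   acos in [carg], it is visibly smooth there. *)
Definition smooth_arg w : R := 2 * atan (complex.Im w / (complex.Re w + normc w)).

Definition smooth_log w : R[i] := ln (normc w) +i* smooth_arg w.

(** With T = v / (u + |w|) one has cos (2 atan T) = u / |w|. As T has the sign of v, 2 atan T lies
    in the half of (-pi, pi) where the matching branch of [carg] inverts cos. *)
Lemma carg_smooth w : off_cut w -> carg w = smooth_arg w.
Proof.
case: w => u v /[dup] /off_cutE; set N := Num.sqrt _ => -[N20 uN] _.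
rewrite /carg /smooth_arg /= -/N.
have N0 : 0 < N by rewrite sqrtr_gt0.
have NE : N ^+ 2 = u ^+ 2 + v ^+ 2 by rewrite sqr_sqrtr // ltW.
set T := v / (u + N).
have cosE : cos (2 * atan T) = u / N.
  rewrite mulrC mulr_natr cos_mulr2n cos_atan exprVn sqr_sqrtr; last first.
    by rewrite addr_ge0 ?sqr_ge0.
  have T1 : 1 + T ^+ 2 = 2 * N / (u + N).
    rewrite /T expr_div_n (_ : v ^+ 2 = N ^+ 2 - u ^+ 2); last by rewrite NE; ring.
    by field; lra.
  rewrite T1 -mulr_natr; field; do ?(apply/andP; split); lra.
have pi0 := pi_gt0 R.
have [v0|v0] := leP 0 v.
  have T0 : 0 <= T by apply: divr_ge0 => //; exact: ltW.
  rewrite -cosE cosK // in_itv /=.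
  have := @atan_ltpi2 R T; have : 0 <= atan T by rewrite -(@atan0 R); apply: le_atan.
  by move=> *; apply/andP; split; lra.
have T0 : T <= 0 by apply: mulr_le0_ge0; rewrite ?invr_ge0; exact: ltW.
rewrite -cosE cosKN ?opprK //.
have := @atan_gtNpi2 R T; have : atan T <= 0 by rewrite -(@atan0 R); apply: le_atan.
by move=> *; apply/andP; split; lra.
Qed.

Lemma clog_smooth w : off_cut w -> clog w = smooth_log w.
Proof. by move=> Pw; rewrite /clog carg_smooth. Qed.

(** * Calculus for complex functions of a real variable *)

Section RealDerivatives.
Implicit Types f g : R -> R.

Lemma is_derive_add_fun f g t df dg : is_derive t 1 f df -> is_derive t 1 g dg ->
  is_derive t 1 (fun x => f x + g x) (df + dg).
Proof. exact: is_deriveD. Qed.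

Lemma is_derive_mul_fun f g t df dg : is_derive t 1 f df -> is_derive t 1 g dg ->
  is_derive t 1 (fun x => f x * g x) (df * g t + f t * dg).
Proof.
move=> hf hg; have := is_deriveM hf hg; rewrite /GRing.scale /= addrC (mulrC df).
exact.
Qed.

Lemma is_derive_inv_fun f t df : f t != 0 -> is_derive t 1 f df ->
  is_derive t 1 (fun x => (f x)^-1) (- df / f t ^+ 2).
Proof.
move=> f0 hf; have := is_deriveV f0 hf; rewrite /GRing.scale /=.
by rewrite mulNr mulrC -mulNr.
Qed.

Lemma is_derive_comp_fun f g t df dg : is_derive (g t) 1 f df -> is_derive t 1 g dg ->
  is_derive t 1 (fun x => f (g x)) (df * dg).
Proof. exact: is_derive1_comp. Qed.
End RealDerivatives.

(** Componentwise and along a real variable: functions are only differentiated along segments. *)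
Definition is_derivC (f : R -> R[i]) t (d : R[i]) :=
  is_derive t 1 (fun x => complex.Re (f x)) (complex.Re d) /\
  is_derive t 1 (fun x => complex.Im (f x)) (complex.Im d).

Lemma is_derivC_eq f t d d' : is_derivC f t d -> d = d' -> is_derivC f t d'.
Proof. by move=> h <-. Qed.

Lemma Re_add z w : complex.Re (z + w) = complex.Re z + complex.Re w.
Proof. by case: z; case: w. Qed.
Lemma Im_add z w : complex.Im (z + w) = complex.Im z + complex.Im w.
Proof. by case: z; case: w. Qed.
Lemma Re_mul z w : complex.Re (z * w) =
  complex.Re z * complex.Re w - complex.Im z * complex.Im w.
Proof. by case: z; case: w. Qed.
Lemma Im_mul z w : complex.Im (z * w) =
  complex.Re z * complex.Im w + complex.Im z * complex.Re w.
Proof. by case: z; case: w. Qed.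

Lemma is_derivC_cst k t : is_derivC (fun=> k) t 0.
Proof. by split; apply: is_derive_cst. Qed.

Lemma is_derivC_real t : is_derivC (fun x => x%:C) t 1.
Proof. by split; [exact: is_derive_id|exact: is_derive_cst]. Qed.

Lemma is_derivCD f g t df dg : is_derivC f t df -> is_derivC g t dg ->
  is_derivC (fun x => f x + g x) t (df + dg).
Proof.
move=> [f1 f2] [g1 g2]; split; rewrite ?Re_add ?Im_add.
  by under eq_fun do rewrite Re_add; apply: is_derive_add_fun.
by under eq_fun do rewrite Im_add; apply: is_derive_add_fun.
Qed.

Lemma is_derivCM f g t df dg : is_derivC f t df -> is_derivC g t dg ->
  is_derivC (fun x => f x * g x) t (df * g t + f t * dg).
Proof.
move=> [f1 f2] [g1 g2]; split; rewrite ?Re_add ?Im_add ?Re_mul ?Im_mul.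
  under eq_fun do rewrite Re_mul -mulNr.
  have f2' : is_derive t 1 (fun x => - complex.Im (f x)) (- complex.Im df).
    exact: is_deriveN.
  by apply: is_derive_eq (is_derive_add_fun (is_derive_mul_fun f1 g1) (is_derive_mul_fun
    f2' g2)) _; ring.
under eq_fun do rewrite Im_mul.
by apply: is_derive_eq (is_derive_add_fun (is_derive_mul_fun f1 g2) (is_derive_mul_fun f2
  g1)) _; ring.
Qed.

Lemma is_derivC_exp f t d : is_derivC f t d ->
  is_derivC (fun x => cexp (f x)) t (d * cexp (f t)).
Proof.
move=> [f1 f2].
have e : is_derive t 1 (fun x => expR (complex.Re (f x)))
    (expR (complex.Re (f t)) * complex.Re d) by apply: is_derive_comp_fun.
have c : is_derive t 1 (fun x => cos (complex.Im (f x)))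
    (- sin (complex.Im (f t)) * complex.Im d) by apply: is_derive_comp_fun.
have s : is_derive t 1 (fun x => sin (complex.Im (f x)))
    (cos (complex.Im (f t)) * complex.Im d) by apply: is_derive_comp_fun.
split; rewrite ?Re_mul ?Im_mul /=.
  by apply: is_derive_eq (is_derive_mul_fun e c) _; ring.
by apply: is_derive_eq (is_derive_mul_fun e s) _; ring.
Qed.

Lemma is_derivC_log f t d : is_derivC f t d -> off_cut (f t) ->
  is_derivC (fun x => smooth_log (f x)) t (d / f t).
Proof.
move=> [f1 f2] Pf.
pose U x := complex.Re (f x); pose V x := complex.Im (f x).
pose N x := Num.sqrt (U x ^+ 2 + V x ^+ 2).
have nE x : normc (f x) = N x by rewrite /N /U /V; case: (f x).
have ft : f t = U t +i* V t by rewrite /U /V; case: (f t).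
have [N20 uN] : 0 < U t ^+ 2 + V t ^+ 2 /\ 0 < U t + N t.
  by apply: off_cutE; rewrite -ft.
have N0 : 0 < N t by rewrite sqrtr_gt0.
have NE : N t ^+ 2 = U t ^+ 2 + V t ^+ 2 by rewrite sqr_sqrtr // ltW.
have N0' : N t != 0 by rewrite gt_eqF.
have uN' : U t + N t != 0 by rewrite gt_eqF.
have dN : is_derive t 1 N ((U t * complex.Re d + V t * complex.Im d) / N t).
  have dN2 : is_derive t 1 (fun x => U x ^+ 2 + V x ^+ 2)
      (2 * (U t * complex.Re d + V t * complex.Im d)).
    under eq_fun do rewrite !expr2.
    by apply: is_derive_eq (is_derive_add_fun (is_derive_mul_fun f1 f1) (is_derive_mul_fun
      f2 f2)) _; rewrite -/(U t) -/(V t); ring.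
  apply: is_derive_eq (@is_derive_comp_fun Num.sqrt (fun x => U x ^+ 2 + V x ^+ 2) t _ _
    (is_derive1_sqrt N20) dN2) _.
  by rewrite -/(N t); field; rewrite ?N0' ?uN'.
have dlog : is_derive t 1 (fun x => ln (N x))
    ((U t * complex.Re d + V t * complex.Im d) / N t ^+ 2).
  apply: is_derive_eq (@is_derive_comp_fun (@ln R) N t _ _ (is_derive1_ln N0) dN) _.
  by field; rewrite ?N0' ?uN'.
have datan := @is_derive_comp_fun (@atan R) (fun x => V x * (U x + N x)^-1) t _ _
  (is_derive1_atan (V t * (U t + N t)^-1))
  (is_derive_mul_fun f2 (@is_derive_inv_fun (fun x => U x + N x) t _ uN' (is_derive_add_fun
    f1 dN))).
have div_ft : d / f t = ((complex.Re d * U t + complex.Im d * V t) / N t ^+ 2) +i*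
    ((complex.Im d * U t - complex.Re d * V t) / N t ^+ 2).
  rewrite ft NE; case: (d) => d1 d2.
  apply/eqP; rewrite eq_complex Re_mul Im_mul /=.
  by apply/andP; split; apply/eqP; field; rewrite gt_eqF.
rewrite div_ft; split => /=.
  under eq_fun do rewrite nE.
  by apply: is_derive_eq dlog _; field; rewrite ?N0' ?uN'.
rewrite /smooth_arg; under eq_fun do rewrite nE.
apply: is_derive_eq (is_derive_mul_fun (is_derive_cst (2 : R) t 1) datan) _.
rewrite /cst mul0r add0r -/(V t) -/(U t) -/(N t).
have T1 : 1 + (V t * (U t + N t)^-1) ^+ 2 = 2 * N t / (U t + N t).
  rewrite expr_div_n (_ : V t ^+ 2 = N t ^+ 2 - U t ^+ 2); last by rewrite NE; ring.
  by field; rewrite ?N0' ?uN'.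
rewrite T1.
(* Here V^2 is traded for N^2 - U^2, the relation that [field] cannot find. *)
have -> : V t * (- (complex.Re d + (U t * complex.Re d + V t * complex.Im d) / N t)
   / (U t + N t) ^+ 2) =
   - (V t * complex.Re d * N t + U t * V t * complex.Re d + (N t ^+ 2 - U t ^+ 2) *
     complex.Im d) /
   (N t * (U t + N t) ^+ 2).
  by rewrite NE; field; rewrite ?N0' ?uN'.
by field; rewrite ?N0' ?uN'.
Qed.

Lemma cexpD z w : cexp (z + w) = cexp z * cexp w.
Proof.
case: z w => [z1 z2] [w1 w2]; rewrite /cexp /= expRD cosD sinD.
by rewrite [RHS]/GRing.mul /=; congr (_ +i* _); ring.
Qed.

Lemma cexp0 : cexp (0 : R[i]) = 1.
Proof. by rewrite /cexp /= expR0 cos0 sin0 mulr1 mulr0. Qed.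

Lemma normc_cexp z : normc (cexp z) = expR (complex.Re z).
Proof.
rewrite /cexp /= !exprMn -mulrDr cos2Dsin2 mulr1 sqrtr_sqr ger0_norm //.
Qed.

Lemma is_derivC_continuous (f : R -> R[i]) (df : R -> R[i]) :
  (forall t, t \in `[0, 1] -> is_derivC f t (df t)) ->
  {within `[0, 1], continuous (fun t => complex.Re (f t))} /\
  {within `[0, 1], continuous (fun t => complex.Im (f t))}.
Proof.
by move=> Hf; split; apply: derivable_within_continuous => t /Hf[h1 h2];
  apply: ex_derive.
Qed.

(** The real mean value theorem gives different points for the real and imaginary parts, whence the
    factor 2. *)
Lemma mean_valueC (f : R -> R[i]) (df : R -> R[i]) (K : R) :
  (forall t, t \in `[0, 1] -> is_derivC f t (df t)) ->
  (forall t, t \in `[0, 1] -> normc (df t) <= K) ->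
  normc (f 1 - f 0) <= 2 * K.
Proof.
move=> Hf HK; have [c1 c2] := is_derivC_continuous Hf.
have sub (t : R) : t \in `]0, 1[ -> t \in `[0, 1] by exact: subset_itv_oo_cc.
have [x1 /sub x1I e1] := MVT ltr01 (fun t ht => (Hf t (sub t ht)).1) c1.
have [x2 /sub x2I e2] := MVT ltr01 (fun t ht => (Hf t (sub t ht)).2) c2.
rewrite subr0 mulr1 in e1; rewrite subr0 mulr1 in e2.
have -> : f 1 - f 0 = (complex.Re (df x1))%:C + (0 +i* complex.Im (df x2)).
  rewrite -e1 -e2; case: (f 1) (f 0) => [u1 v1] [u2 v2] /=.
  by congr (_ +i* _); rewrite ?addr0 ?add0r.
have nRe z : normc (complex.Re z)%:C <= normc z.
  by rewrite normc_real -lecR; apply: normc_ge_Re.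
have nIm z : normc (0 +i* complex.Im z) <= normc z.
  case: z => u v; rewrite /= expr0n add0r; apply: ler_wsqrtr.
  by rewrite lerDr sqr_ge0.
apply: le_trans (normcD _ _) _.
have := le_trans (nRe _) (HK _ x1I); have := le_trans (nIm _) (HK _ x2I); lra.
Qed.

(** * The binomial series of (1 - y)^s *)

Definition bin_coef s n : R[i] := poch (- s) n / n`!%:R.

Lemma bin_coefS s n : n.+1%:R * bin_coef s n.+1 = (n%:R - s) * bin_coef s n.
Proof.
rewrite /bin_coef factS natrM /poch big_ord_recr /=.
have h1 : n.+1%:R != 0 :> R[i] by rewrite pnatr_eq0.
have h2 : n`!%:R != 0 :> R[i] by rewrite pnatr_eq0 -lt0n fact_gt0.
by move: (n.+1%:R) (n`!%:R) h1 h2 => x y h1 h2; field; rewrite h1 h2.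
Qed.

Lemma normc_natr n : normc (n%:R : R[i]) = n%:R.
Proof. by rewrite (_ : n%:R = n%:R%:C) ?normc_real ?ger0_norm // rmorph_nat. Qed.

(** Ratio test: by [bin_coefS] the ratio is at most (1 + |s| / (n+1)) rho, eventually below (1 +
    rho) / 2 < 1. *)
Lemma bin_coef_cvg0 s (rho : R) : 0 <= rho < 1 ->
  (fun n => n.+1%:R * normc (bin_coef s n.+1) * rho ^+ n) @ \oo --> (0 : R).
Proof.
move=> /andP[r0 r1]; set x := fun n => _.
have x0 n : 0 <= x n by rewrite !mulr_ge0 ?normc_ge0 ?exprn_ge0.
have xS n : x n.+1 <= (1 + normc s / n.+1%:R) * rho * x n.
  rewrite {1}/x -normc_natr -Normc.normcM bin_coefS Normc.normcM /x.
  rewrite exprS; set c := normc (bin_coef _ _).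
  have : normc (n.+1%:R - s) <= n.+1%:R + normc s by rewrite -normc_natr -(normcN s) normcD.
  move=> h; apply: (@le_trans _ _ ((n.+1%:R + normc s) * c * (rho * rho ^+ n))).
    by rewrite !ler_wpM2r ?normc_ge0 ?mulr_ge0 ?exprn_ge0.
  have n1 : n.+1%:R != 0 :> R by rewrite pnatr_eq0.
  by rewrite le_eqVlt; apply/orP; left; apply/eqP; field.
pose r' := (1 + rho) / 2.
have [N HN] : exists N, forall n, (N <= n)%N -> (1 + normc s / n.+1%:R) * rho <= r'.
  have [N HN] : exists N : nat, 2 * normc s <= (1 - rho) * N%:R.
    have h : 0 <= 2 * normc s / (1 - rho).
      by rewrite divr_ge0 ?mulr_ge0 ?normc_ge0 //; lra.
    exists (Num.Def.archi_bound (2 * normc s / (1 - rho))).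
    by have := ltW (archi_boundP h); rewrite ler_pdivrMr ?subr_gt0 // (mulrC (1 - rho)).
  exists N => n leNn; have n0 : 0 < n.+1%:R :> R by rewrite ltr0n.
  rewrite mulrDl mul1r mulrAC -lerBrDl ler_pdivrMr // /r'.
  have : (1 - rho) * N%:R <= (1 - rho) * n.+1%:R :> R.
    by apply: ler_wpM2l; [lra|rewrite ler_nat; lia].
  have : normc s * rho <= normc s by rewrite ler_piMr ?normc_ge0 // ltW.
  lra.
have geo k : x (k + N)%N <= x N * r' ^+ k.
  elim: k => [|k IH]; first by rewrite expr0 mulr1.
  apply: le_trans (xS _) _; apply: (@le_trans _ _ (r' * x (k + N)%N)).
    by rewrite ler_wpM2r // HN // leq_addl.
  rewrite exprS [leRHS]mulrCA; apply: ler_wpM2l => //; rewrite /r'; lra.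
rewrite -(cvg_shiftn N); apply: (@squeeze_cvgr _ _ _ _ (fun=> 0) (fun k => x N * r' ^+ k)).
- by apply: nearW => k /=; rewrite x0; apply: geo.
- exact: cvg_cst.
have : `|r'| < 1 by rewrite ger0_norm /r'; lra.
by move=> h; apply: (@cvg_geometric R (x N) r' h).
Qed.

Definition binomial_sum s N (y : R[i]) := \sum_(0 <= n < N) bin_coef s n * y ^+ n.

(** (1 - y)^s solves (1 - y) S' + s S = 0; for a partial sum everything cancels except one boundary
    term. At n = 0 the truncated [n.-1] is harmless because of the factor n. *)
Lemma binomial_ode s N (y : R[i]) :
  (1 - y) * (\sum_(0 <= n < N.+1) n%:R * bin_coef s n * y ^+ n.-1)
  + s * binomial_sum s N.+1 y = - (N.+1%:R * bin_coef s N.+1 * y ^+ N).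
Proof.
rewrite /binomial_sum; elim: N => [|N IH].
  by rewrite !big_nat1 bin_coefS /= !mul0r expr0 !mulr1 mulr0; ring.
rewrite big_nat_recr //= [X in s * X]big_nat_recr //= mulrDr mulrDr addrACA IH.
by rewrite (bin_coefS s N.+1) exprS; ring.
Qed.

Lemma is_derivC_sum (F : nat -> R -> R[i]) dF t N :
  (forall n, is_derivC (F n) t (dF n)) ->
  is_derivC (fun x => \sum_(0 <= n < N) F n x) t (\sum_(0 <= n < N) dF n).
Proof.
move=> h; elim: N => [|N IH].
  under eq_fun do rewrite big_nil; rewrite big_nil; exact: is_derivC_cst.
under eq_fun do rewrite big_nat_recr //=; rewrite big_nat_recr //=.
exact: is_derivCD.
Qed.

Lemma is_derivCX f t d n : is_derivC f t d ->
  is_derivC (fun x => f x ^+ n) t (n%:R * f t ^+ n.-1 * d).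
Proof.
move=> h; elim: n => [|n IH].
  under eq_fun do rewrite expr0; rewrite !mul0r; exact: is_derivC_cst.
under eq_fun do rewrite exprS; apply: is_derivC_eq (is_derivCM h IH) _.
case: n {IH} => [|n]; first by rewrite /= !mul0r !expr0 mulr0; ring.
by rewrite /= !exprS -!natr1; ring.
Qed.

(* With y = u t, the product of the N-th partial sum of the binomial series of
   (1 - y)^s by (w (1 - y))^(-s) has, by [binomial_ode], a derivative in t which
   tends to 0 uniformly on [0, 1]. *)
Lemma binomial_cvg s (w u : R[i]) : normc u < 1 ->
  (forall t, t \in `[0, 1] -> off_cut (w * (1 - t%:C * u))) ->
  cvgC (fun N => \sum_(0 <= n < N) cpow w s * bin_coef s n * u ^+ n)
    (cpow (w * (1 - u)) s).
Proof.
move=> u1 Hcut.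
have It (x : R) : (x \in `[0, 1]) = (0 <= x <= 1) by rewrite in_itv.
have I0 : (0 : R) \in `[0, 1] by rewrite It lexx ler01.
have I1 : (1 : R) \in `[0, 1] by rewrite It lexx ler01.
pose D t := w * (1 - t%:C * u).
have D0 : D 0 = w by rewrite /D mul0r subr0 mulr1.
have D1 : D 1 = w * (1 - u) by rewrite /D mul1r.
have dy t : is_derivC (fun x => x%:C * u) t u.
  by apply: is_derivC_eq (is_derivCM (is_derivC_real t) (is_derivC_cst u t)) _; ring.
have dD t : is_derivC D t (- w * u).
  have d1 := is_derivCD (is_derivC_cst 1 t) (is_derivCM (is_derivC_cst (-1) t) (dy t)).
  have := is_derivCM (is_derivC_cst w t) d1; rewrite /D.
  under eq_fun do rewrite mulN1r.
  by move/is_derivC_eq; apply; ring.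
(* This is D(t)^(-s), written with [smooth_log] so that it can be differentiated. *)
pose E t := cexp (- s * smooth_log (D t)).
have dL t : t \in `[0, 1] -> is_derivC (fun x => - s * smooth_log (D x)) t (- s * (- w * u
  / D t)).
  move=> tI.
  have dl := is_derivC_log (dD t) (Hcut t tI).
  by apply: is_derivC_eq (is_derivCM (is_derivC_cst (- s) t) dl) _; ring.
have dE t (tI : t \in `[0, 1]) := is_derivC_exp (dL t tI).
have w0 : w != 0.
  apply/eqP => w0; apply: (Hcut 0 I0); rewrite w0 mul0r; split => //=.
have y1 t : t \in `[0, 1] -> 1 - normc u <= normc (1 - t%:C * u).
  rewrite It => /andP[t0 t1].
  have := normc_dist 1 (t%:C * u); rewrite Normc.normc1 Normc.normcM normc_real ger0_norm //.
  have : t * normc u <= normc u by rewrite ler_piMl ?normc_ge0.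
  lra.
have y0 t (tI : t \in `[0, 1]) : 1 - t%:C * u != 0.
  by rewrite -normc_gt0; apply: lt_le_trans (y1 t tI); lra.
pose df N t := - (N.+1%:R * bin_coef s N.+1 * (t%:C * u) ^+ N) * (u / (1 - t%:C * u) * E t).
have dp N t (tI : t \in `[0, 1]) :
    is_derivC (fun x => binomial_sum s N.+1 (x%:C * u) * E x) t (df N t).
  have dterm n : is_derivC (fun x => bin_coef s n * (x%:C * u) ^+ n) t
      (bin_coef s n * (n%:R * (t%:C * u) ^+ n.-1 * u)).
    apply: is_derivC_eq (is_derivCM (is_derivC_cst _ t) (is_derivCX n (dy t))) _.
    by rewrite mul0r add0r.
  apply: is_derivC_eq (is_derivCM (is_derivC_sum N.+1 dterm) (dE t tI)) _.
  rewrite /df -binomial_ode -/(binomial_sum s N.+1 (t%:C * u)) -/(E t).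
  have -> : \sum_(0 <= n < N.+1) bin_coef s n * (n%:R * (t%:C * u) ^+ n.-1 * u) =
      u * \sum_(0 <= n < N.+1) n%:R * bin_coef s n * (t%:C * u) ^+ n.-1.
    by rewrite mulr_sumr; apply: eq_bigr => n _; ring.
  by rewrite /D; field; rewrite w0 y0.
have [c1 _] := is_derivC_continuous dL.
(* |E t| is the exponential of a continuous real part, so a maximum on [0, 1] bounds it
   uniformly. *)
have [x0 _ Hx0] := EVT_max ler01 c1.
pose K := expR (complex.Re (- s * smooth_log (D x0))).
pose K' := K / (1 - normc u).
have dfK N t (tI : t \in `[0, 1]) :
    normc (df N t) <= (N.+1%:R * normc (bin_coef s N.+1) * normc u ^+ N) * K'.
  rewrite /df; move: (bin_coef s N.+1) => B.
  rewrite Normc.normcM normcN !Normc.normcM normcX Normc.normcV normc_cexp normc_natr.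
  have [t0 t1] : 0 <= t /\ t <= 1 by apply/andP; rewrite -It.
  have nt : normc (t%:C * u) <= normc u.
    by rewrite Normc.normcM normc_real ger0_norm // ler_piMl ?normc_ge0.
  have nu := normc_ge0 u.
  have nt0 := normc_ge0 (t%:C * u).
  apply: ler_pM; rewrite ?mulr_ge0 ?normc_ge0 ?exprn_ge0 ?invr_ge0 ?expR_ge0 ?normc_ge0 //.
    by rewrite ler_wpM2l ?mulr_ge0 ?normc_ge0 // lerXn2r ?nnegrE.
  rewrite /K' mulrC; apply: ler_pM; rewrite ?mulr_ge0 ?invr_ge0 ?expR_ge0 ?normc_ge0 //.
    by rewrite ler_expR Hx0.
  rewrite -[leRHS]mul1r; apply: ler_pM; rewrite ?invr_ge0 ?normc_ge0 //; first exact: ltW.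
  by rewrite lef_pV2 ?posrE ?y1 // ?(lt_le_trans _ (y1 t tI)); lra.
have mvb N := mean_valueC (dp N) (dfK N).
have p0 N : binomial_sum s N.+1 (0%:C * u) = 1.
  rewrite /binomial_sum mul0r big_nat_recl // big1 => [|i _]; last by rewrite expr0n mulr0.
  by rewrite expr0 mulr1 addr0 /bin_coef /poch big_ord0 fact0 divr1.
have lim : cvgC (fun N => binomial_sum s N.+1 u * E 1) (E 0).
  apply: cvgC_le (fun N => 2 * (N.+1%:R * normc (bin_coef s N.+1) * normc u ^+ N * K')) _ _.
    by move=> N; have := mvb N; rewrite p0 !mul1r.
  have -> : (0 : R) = 2 * (0 * K') by rewrite mul0r mulr0.
  apply: cvgM; first exact: cvg_cst.
  apply: cvgM; last exact: cvg_cst.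
  by apply: bin_coef_cvg0; rewrite normc_ge0 u1.
have cE t (tI : t \in `[0, 1]) : E t * cpow (D t) s = 1.
  rewrite /E /cpow clog_smooth; last exact: Hcut.
  by rewrite -cexpD mulNr addNr cexp0.
(* So far the partial sums at u times E(1) tend to E(0). As E inverts the power at both ends, this
   factor turns that into the claim. *)
have := cvgCM lim (cvgC_cst (cpow w s * cpow (w * (1 - u)) s)).
have e0 := cE 0 I0; have e1 := cE 1 I1; rewrite D0 in e0; rewrite D1 in e1.
rewrite (mulrA (E 0)) e0 mul1r => h; apply/(cvgC_shift 1).
move: h; congr (cvgC _ _); apply/funext => N; rewrite addn1.
rewrite [X in _ * X]mulrC -mulrA (mulrA (E 1)) e1 mul1r mulr_suml.
by apply: eq_bigr => n _; ring.
Qed.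

Lemma slit_off_cut z : slit_plane z -> off_cut (1 - z).
Proof.
case: z => u v sz [/= im re]; apply: sz; split => /=; first lra.
lra.
Qed.

Lemma cpow_binomial_series s z : normc z < 1 ->
  cvgC (fun N => \sum_(0 <= n < N) bin_coef s n * z ^+ n) (cpow (1 - z) s).
Proof.
move=> z1; have cut w : normc w < 1 -> off_cut (1 - w).
  move=> w1; apply: slit_off_cut; case: w w1 => u v w1 [/= v0 u1].
  by move: w1; rewrite /= v0 expr0n addr0 sqrtr_sqr ger0_norm; lra.
have := @binomial_cvg s 1 z z1.
have -> : cpow 1 s = 1 :> R[i].
  rewrite /cpow clog_smooth; last by case=> _ /=; lra.
  rewrite /smooth_log /smooth_arg Normc.normc1 ln1 /= mul0r atan0 mulr0.
  by rewrite mulr0 cexp0.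
rewrite mul1r => h; have {}h := h _; move: h; under eq_fun do under eq_bigr do rewrite mul1r.
apply=> t; rewrite in_itv /= => /andP[t0 t1]; rewrite mul1r; apply: cut.
rewrite Normc.normcM normc_real ger0_norm //; apply: le_lt_trans z1.
by rewrite ler_piMl ?normc_ge0.
Qed.

(** Off the real axis the radius |v| avoids the axis; on it, the radius 1 - u stays to the left of
    1. *)
Lemma slit_plane_open z0 : @slit_plane R z0 ->
  exists2 e : R, 0 < e & forall z, normc (z - z0) < e -> slit_plane z.
Proof.
case: z0 => u v sz.
have ReIm z : `|complex.Re z| <= normc z /\ `|complex.Im z| <= normc z.
  case: z => p q; rewrite -lecR /=; split; first exact: (normc_ge_Re (p +i* q)).
  by rewrite -[`|q|]sqrtr_sqr ler_wsqrtr // lerDr sqr_ge0.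
have [v0|v0] := eqVneq v 0.
  have u1 : u < 1 by rewrite ltNge; apply/negP => u1; apply: sz.
  exists (1 - u) => [|z zlt [im re]]; first lra.
  have h : complex.Re z - u <= normc (z - (u +i* v)).
    have [+ _] := ReIm (z - (u +i* v)); apply: le_trans.
    by case: (z) => p q; apply: ler_norm.
  lra.
exists `|v| => [|z zlt [im re]]; first by rewrite normr_gt0.
have h : `|v| <= normc (z - (u +i* v)).
  have [_] := ReIm (z - (u +i* v)); apply: le_trans.
  by case: (z) im => p q /= ->; rewrite sub0r normrN.
lra.
Qed.

(** Write 1 - z = w (1 - h / w) with w = 1 - z0, h = z - z0 and use [binomial_cvg]: the disc is
    small enough for |h| < |w| and for the segment from z0 to z to stay in the slit plane. *)
Lemma analytic_on_cpow s : analytic_on (@slit_plane R) (fun z => cpow (1 - z) s).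
Proof.
move=> z0 sz0; set w := 1 - z0.
have [e e0 He] := slit_plane_open sz0.
have w0 : w != 0.
  by apply/eqP => w0; apply: (slit_off_cut sz0); rewrite -/w w0.
exists (fun n => cpow w s * bin_coef s n / w ^+ n); apply/nearCP.
have nw : 0 < normc w by rewrite normc_gt0.
exists (Num.min e (normc w)) => [|z]; first by rewrite lt_min e0.
rewrite lt_min => /andP[ze zw]; set h := z - z0 in ze zw *.
apply/pseries_cvgP; have := @binomial_cvg s w (h / w).
have -> : w * (1 - h / w) = 1 - z.
  by transitivity (w - h); [field|rewrite /w /h; ring].
move=> H; have {}H := H _ _; move: H; under eq_fun do under eq_bigr do rewrite expr_div_n.
have -> : (fun N => \sum_(0 <= n < N) cpow w s * bin_coef s n * (h ^+ n / w ^+ n)) =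
   (fun N => \sum_(0 <= n < N) cpow w s * bin_coef s n / w ^+ n * h ^+ n).
  by apply/funext => N; apply: eq_bigr => n _; ring.
apply; first by rewrite Normc.normcM Normc.normcV ltr_pdivrMr ?mul1r.
move=> t; rewrite in_itv /= => /andP[t0 t1].
have -> : w * (1 - t%:C * (h / w)) = 1 - (z0 + t%:C * h).
  by transitivity (w - t%:C * h); [field|rewrite /w; ring].
apply/slit_off_cut/He; rewrite addrC addKr Normc.normcM normc_real ger0_norm //.
by apply: le_lt_trans ze; rewrite ler_piMl ?normc_ge0.
Qed.
End ComplexPower.

(** * Power series of both sides *)

(** A zero factor would give a - b = q - j with 0 <= j < m, an excluded integer. *)
Lemma poch_int_neq0 (K : numFieldType) (a b : K) (m q : nat) :
  (forall i : int, q%:Z + 1 - m%:Z <= i <= q%:Z -> a - b <> i%:~R) ->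
  forall i, (i <= m)%N -> poch (a - b - q%:R) i != 0.
Proof.
move=> ab i leim; apply/eqP => /poch_eq0[j ltji e].
apply: (ab (q%:Z - j%:Z)); first by apply/andP; split; lia.
by rewrite rmorphB /= -[LHS](subrK q%:R) e addrC.
Qed.

Section GammaRatio.
Variables (K : numFieldType) (d : nat) (gamma : 'I_d -> K) (kappa s : K) (P : K -> K).
Hypothesis PE : forall t, P t = kappa * \prod_i (t - gamma i).

Lemma gamma_ratio N : (forall i, poch (gamma i + s) N != 0) ->
  P (- s) * (\prod_(u <- [seq gamma i + s + 1 | i <- enum 'I_d]) poch u N
    / \prod_(v <- [seq gamma i + s | i <- enum 'I_d]) poch v N) =
  P (- s - N%:R).
Proof.
move=> g0; rewrite !PE -mulrA; congr (_ * _).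
rewrite 2!big_map !big_enum /= -prodfV -!big_split; apply: eq_bigr => i _ /=.
have e : (gamma i + s) * poch (gamma i + s + 1) N =
    poch (gamma i + s) N * (gamma i + s + N%:R) by rewrite -pochSl pochS.
have -> : - s - gamma i = - (gamma i + s) by ring.
by rewrite mulNr mulrA e; field.
Qed.
End GammaRatio.

Section CoefficientsGamma.
Variables (K : numFieldType) (r : nat) (f : 'I_r -> K) (mv : 'I_r -> nat) (a b : K).
Variables (m q : nat) (gamma : 'I_(m - q - 1) -> K) (kappa : K).
Hypothesis f_bottom : forall (j : 'I_r) (n : nat), f j <> - n%:R.
Hypothesis m_def : m = (\sum_j mv j)%N.
Hypothesis q_lt_m : (q < m)%N.
Hypothesis c_bottom : forall n : nat, a + m%:R - q%:R <> - n%:R.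
Hypothesis ab : forall i, (i <= m)%N -> poch (a - b - q%:R) i != 0.
Hypothesis RhatE : forall t : K,
  Rhat f mv a b m q t = kappa * \prod_(i < m - q - 1) (t - gamma i).
Hypothesis gamma_bottom : forall (i : 'I_(m - q - 1)) (n : nat),
  gamma i + q%:R + 1 = - n%:R -> exists2 N : nat, (N <= n)%N & a - b + 1 = - N%:R.

Let gamma_term := hyp_term
  (1 :: a - b + 1 :: [seq gamma i + q%:R + 2 | i <- enum 'I_(m - q - 1)])
  (a + m%:R + 1 :: [seq gamma i + q%:R + 1 | i <- enum 'I_(m - q - 1)]).

Lemma prod_coef_gamma N :
  prod_coef f mv a b m q (N + q.+1) =
  Rhat f mv a b m q (- q%:R - 1) * poch (b - a) q.+1
    / poch (a + m%:R - q%:R) q.+1 * gamma_term N.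
Proof.
set c := a + m%:R - q%:R; have c0 n : poch c n != 0 by apply: poch_c_neq0.
apply: (mulfI (c0 (N + q.+1)%N)).
rewrite prod_coef_gt //; last by lia.
have -> : - (N + q.+1)%:R = - (q%:R + 1) - N%:R :> K by rewrite natrD -natr1; ring.
have -> : gamma_term N = poch (a - b + 1) N / poch (a + m%:R + 1) N *
   (\prod_(u <- [seq gamma i + (q%:R + 1) + 1 | i <- enum 'I_(m - q - 1)]) poch u N
    / \prod_(v <- [seq gamma i + (q%:R + 1) | i <- enum 'I_(m - q - 1)]) poch v N).
  have -> : poch (a - b + 1) N / poch (a + m%:R + 1) N =
      poch 1 N * poch (a - b + 1) N / (poch (a + m%:R + 1) N * N`!%:R).
    have -> : poch 1 N = N`!%:R :> K by have := @fact_poch K 0 N; rewrite mul1r.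
    by rewrite (mulrC _ N`!%:R) -mulf_div divff ?fact_neq0 // mul1r.
  rewrite /gamma_term /hyp_term 3!big_cons.
  have -> : [seq gamma i + q%:R + 2 | i <- enum 'I_(m - q - 1)] =
      [seq gamma i + (q%:R + 1) + 1 | i <- enum 'I_(m - q - 1)].
    by apply: eq_map => i; ring.
  have -> : [seq gamma i + q%:R + 1 | i <- enum 'I_(m - q - 1)] =
      [seq gamma i + (q%:R + 1) | i <- enum 'I_(m - q - 1)].
    by apply: eq_map => i; ring.
  by rewrite !invfM; ring.
have eab : a - b + 1 = a - b - q%:R + q.+1%:R by rewrite -natr1; ring.
have ec : a + m%:R + 1 = c + q.+1%:R by rewrite /c -natr1; ring.
(* Once (a - b + 1)_N = 0 both sides vanish, the left one because (a - b - q)_{q+1+N} contains this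
   factor. Otherwise [gamma_bottom] keeps the bottom symbols nonzero. *)
have [ab0|ab0] := eqVneq (poch (a - b + 1) N) 0.
  by rewrite ab0 addnC pochD -eab ab0 !(mul0r, mulr0).
have g0 i : poch (gamma i + (q%:R + 1)) N != 0.
  apply/eqP => /poch_eq0[n ltnN]; rewrite addrA => /gamma_bottom[M leM e].
  by move/eqP: ab0; apply; apply/poch_eq0; exists M => //; lia.
rewrite -(gamma_ratio RhatE g0) poch_opp_sub opprD.
rewrite addnC !pochD -eab -ec.
have cm0 : poch (a + m%:R + 1) N != 0.
  by have := c0 (q.+1 + N)%N; rewrite pochD -ec mulf_eq0 negb_or => /andP[].
have := c0 q.+1; move: (\prod_(u <- _) _ / \prod_(v <- _) _) cm0 => X.
move: (poch c q.+1) (poch (a + m%:R + 1) N) (poch (a - b - q%:R) q.+1) => x1 x2 x3 x20 x10.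
by field; rewrite x10 x20.
Qed.
End CoefficientsGamma.

Lemma hyp_continuation_cvgC (R : realType) (ups lows : seq R[i]) F z :
  hyp_continuation ups lows F -> normc z < 1 ->
  cvgC (fun N => \sum_(0 <= n < N) hyp_term ups lows n * z ^+ n) (F z).
Proof.
move=> [_ HF] z1; have : `|z| < 1 by move: z1; rewrite -ltcR.
by move=> /HF /pseries_cvgP; rewrite subr0.
Qed.

Lemma hyp_continuation_abs_summable (R : realType) (ups lows : seq R[i]) F z :
  hyp_continuation ups lows F -> normc z < 1 ->
  abs_summable (fun n => hyp_term ups lows n * z ^+ n).
Proof.
move=> HF z1; have z0 := normc_ge0 z; set w : R[i] := ((1 + normc z) / 2)%:C.
have nw : normc w = (1 + normc z) / 2 by rewrite normc_real ger0_norm //; lra.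
apply: (@pseries_abs_summable _ _ w _ (F w)); last by lra.
by apply: hyp_continuation_cvgC => //; lra.
Qed.

Lemma bin_coef_abs_summable (R : realType) (s z : R[i]) : normc z < 1 ->
  abs_summable (fun n => bin_coef s n * z ^+ n).
Proof.
move=> z1; have z0 := normc_ge0 z; set w : R[i] := ((1 + normc z) / 2)%:C.
have nw : normc w = (1 + normc z) / 2 by rewrite normc_real ger0_norm //; lra.
apply: (@pseries_abs_summable _ _ w _ (cpow (1 - w) s)); last by lra.
by apply: cpow_binomial_series; lra.
Qed.

Theorem theorem3 (R : realType) (a b : R[i]) (r : nat) (mv : 'I_r -> nat)
    (f : 'I_r -> R[i]) (m q : nat)
    (r_gt0 : (0 < r)%N)
    (mv_gt0 : forall j : 'I_r, (0 < mv j)%N)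
    (m_def : m = (\sum_(j < r) mv j)%N)
    (q_lt_m : (q < m)%N)
    (f_bottom : forall (j : 'I_r) (n : nat), f j <> - n%:R)
    (c_bottom : forall n : nat, a + m%:R - q%:R <> - n%:R)
    (ab : forall i : int, q%:Z + 1 - m%:Z <= i <= q%:Z -> a - b <> i%:~R)
    (fa : forall j : 'I_r, m%:Z - q%:Z - (mv j)%:Z <= 0 ->
      forall i : int, m%:Z - q%:Z - (mv j)%:Z <= i <= 0 -> f j - a <> i%:~R) :
  (forall gamma : 'I_(m - q - 1) -> R[i],
     (* the gamma_i are the zeros of \hat R_{m-q-1} *)
     (exists2 kappa : R[i], kappa <> 0 &
        forall t : R[i],
          Rhat f mv a b m q t = kappa * \prod_(i < m - q - 1) (t - gamma i)) ->
     (* no bottom parameter gamma_i + q + 1 is a nonpositive integer -n, unless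
        the series has terminated by then through the top one a - b + 1 *)
     (forall (i : 'I_(m - q - 1)) (n : nat), gamma i + q%:R + 1 = - n%:R ->
        exists2 N : nat, (N <= n)%N & a - b + 1 = - N%:R) ->
     forall F G : R[i] -> R[i],
     hyp_continuation (a :: b :: shifted f mv)
       (a + m%:R - q%:R :: [seq f j | j <- enum 'I_r]) F ->
     hyp_continuation
       (1 :: a - b + 1 ::
          [seq gamma i + q%:R + 2 | i <- enum 'I_(m - q - 1)])
       (a + m%:R + 1 ::
          [seq gamma i + q%:R + 1 | i <- enum 'I_(m - q - 1)]) G ->
     forall x : R[i], slit_plane x ->
       cpow (1 - x) (b + q%:R) * F x =
         \sum_(0 <= j < q.+1)
            poch (- q%:R) j * poch (a - b - q%:R) j
            / (poch (a + m%:R - q%:R) j * j`!%:R)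
            * Qhat0 f mv a b m q j * x ^+ j
         + x ^+ q.+1
           * (Rhat f mv a b m q (- q%:R - 1) * poch (b - a) q.+1
              / poch (a + m%:R - q%:R) q.+1)
           * G x)
  /\
  Rhat f mv a b m q (- q%:R - 1) =
    poch b q.+1 / poch (b - a) q.+1
    * \sum_(0 <= k < q.+2)
        poch (- m%:R + k%:R) (q + 1 - k) * poch a k * Ccoef f mv k
        / (q + 1 - k)`!%:R.
Proof.
have ab0 := poch_int_neq0 ab.
split; last exact: Rhat_qS.
move=> gamma [kappa _ RhatE] gamma_bottom F G HF HG.
set s := b + q%:R; set lead := _ / poch _ q.+1.
pose p j := poch (- q%:R) j * poch (a - b - q%:R) j
  / (poch (a + m%:R - q%:R) j * j`!%:R) * Qhat0 f mv a b m q j.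
pose rhs x := \sum_(0 <= j < q.+1) p j * x ^+ j + x ^+ q.+1 * lead * G x.
(* In this form analyticity follows from the rules for sums and products alone. *)
suff key x : slit_plane x -> cpow (1 - x) s * F x + (-1) * rhs x = 0.
  by move=> x /key /eqP; rewrite mulN1r subr_eq0 => /eqP.
apply: (@analytic_slit_identity _ (fun x => cpow (1 - x) s * F x + (-1) * rhs x)) => {x}.
  apply: analytic_onD.
    by apply: analytic_onM; [exact: analytic_on_cpow|case: HF].
  apply: analytic_onM; first exact: analytic_on_cst.
  apply: analytic_onD.
    apply: analytic_on_sum => j.
    by apply: analytic_onM; [exact: analytic_on_cst|exact: analytic_onX].
  apply: analytic_onM; last by case: HG.
  by apply: analytic_onM; [exact: analytic_onX|exact: analytic_on_cst].
move=> x x1; rewrite mulN1r; apply/eqP; rewrite subr_eq0; apply/eqP.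
have coefs : cvgC (fun N => \sum_(0 <= n < N) prod_coef f mv a b m q n * x ^+ n)
    (cpow (1 - x) s * F x).
  have := cauchy_product (@bin_coef_abs_summable _ s x x1) (hyp_continuation_abs_summable
    HF x1)
    (@cpow_binomial_series _ s x x1) (hyp_continuation_cvgC HF x1).
  congr (cvgC _ _); apply/funext => N; apply: eq_bigr => n _.
  rewrite /prod_coef mulr_suml; apply: eq_bigr => -[i /= lti] _.
  by rewrite mulrACA -exprD subnK // /bin_coef opprD.
(* A partial sum with N + q + 1 terms is the polynomial part plus exactly N terms of the series of
   G. *)
apply: (cvgC_unique coefs); apply/(cvgC_shift q.+1).
have low j : (j < q.+1)%N -> prod_coef f mv a b m q j = p j.
  move=> ltj; have c0 := poch_c_neq0 c_bottom j.
  apply: (mulfI c0); rewrite prod_coef_le // /p invfM.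
  by have n0 := fact_neq0 R[i] j; field; rewrite n0 c0.
have := cvgCD (cvgC_cst (\sum_(0 <= j < q.+1) p j * x ^+ j))
  (cvgCM (cvgC_cst (x ^+ q.+1 * lead)) (hyp_continuation_cvgC HG x1)).
congr (cvgC _ _); apply/funext => N.
rewrite [RHS](@big_cat_nat _ _ _ q.+1) ?leq_addl //=; congr (_ + _).
  by rewrite !big_nat; apply: eq_bigr => j /andP[_ /low ->].
rewrite -[X in _ = \sum_(X <= _ < _) _](add0n q.+1) big_addn addnK mulr_sumr; apply:
  eq_bigr => n _.
rewrite (prod_coef_gamma f_bottom m_def q_lt_m c_bottom ab0 RhatE gamma_bottom) -/lead exprD.
by ring.
Qed.
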